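(* Let $N\ge 2$, $n=N^2-1$, and let $X_1,\dots,X_n$ be the ordered basis of $\mathfrak{sl}(N,\mathbb{C})$ described in the context. For $u=(u_1,\dots,u_n)\in\mathbb{C}^n$ group the coordinates as follows: for $k=1,\dots,N-1$ let $\mathbf{u}_{(k)}\in\mathbb{C}^{N-k}$ be the column vector of those $u_m$ with $X_m\in\mathfrak{a}_k$, let $\mathbf{v}\in\mathbb{C}^{N-1}$ be the column vector of those $u_m$ with $X_m\in\mathfrak{h}$, and let $\widetilde{\mathbf{u}}_{(k)}\in\mathbb{C}^{N-k}$ be the column vector of those $u_m$ with $X_m\in\widetilde{\mathfrak{a}}_k$. Then there exist functions, depending only on $N$, (i) for each $k=1,\dots,N-1$: $\mathbf{c}_{(k)}$ and $\mathbf{b}_{(k)}$ (with values in $\mathbb{C}^{N-k}$) and $C_{(k)}$ (with values in $(N-k)\times(N-k)$ complex matrices), all functions of $\mathbf{a}=(a_1,\dots,a_n)\in\mathbb{C}^n$ and of $\mathbf{u}_{(1)},\dots,\mathbf{u}_{(k-1)}$ only; (ii) $\mathbf{f}$ with values in $\mathbb{C}^{N-1}$, a function of $\mathbf{a}$ and $\mathbf{u}_{(1)},\dots,\mathbf{u}_{(N-1)}$ only; (iii) for each $k=1,\dots,N-1$: $\mathbf{d}_{(k)}$ with values in $\mathbb{C}^{N-k}$ and $D_{(k)}$ with values in $(N-k)\times(N-k)$ complex matrices, functions of $\mathbf{a}$, $\mathbf{u}_{(1)},\dots,\mathbf{u}_{(N-1)}$, $\mathbf{v}$ and $\widetilde{\mathbf{u}}_{(l)}$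 with $l>k$ only; such that the following holds. Let $I\subset\mathbb{R}$ be an interval, let $M(t)=\sum_{k=1}^n a_k(t)X_k$, $t\in I$, be any curve in $\mathfrak{sl}(N,\mathbb{C})$ (in particular, any curve in $\mathfrak{su}(N)$), let $u_1,\dots,u_n:I\to\mathbb{C}$ be differentiable, and put $$K(t)=\exp(u_1(t)X_1)\exp(u_2(t)X_2)\cdots\exp(u_n(t)X_n).$$ Then $K'(t)=M(t)K(t)$ on $I$ if and only if the $u_m$ satisfy on $I$ the hierarchy consisting of (1) the matrix Riccati equations $\mathbf{u}_{(k)}'=\mathbf{c}_{(k)}+C_{(k)}\mathbf{u}_{(k)}+\mathbf{u}_{(k)}\mathbf{u}_{(k)}^T\mathbf{b}_{(k)}$ for $k=1,\dots,N-1$; (2) the equation $\mathbf{v}'=\mathbf{f}$, which is solved by integration once the solutions of (1) are known; (3) the linear equations $\widetilde{\mathbf{u}}_{(k)}'=\mathbf{d}_{(k)}+D_{(k)}\widetilde{\mathbf{u}}_{(k)}$ for $k=N-1,N-2,\dots,1$, where all coefficient functions are evaluated at $\mathbf{a}(t)$ and at the indicated components of $u(t)$.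
   Context: $S_{kl}=e_ke_l^\dagger$ denotes the $N\times N$ matrix unit with a single entry $1$ in position $(k,l)$. The ordered basis $X_1,\dots,X_{N^2-1}$ of $\mathfrak{sl}(N,\mathbb{C})$ is: - $X_m=S_{pq}$ with $m=\frac{(N+q-1)(N-q)}{2}+p$, for $1\le p<q\le N$; - $X_m=S_{ll}-S_{l+1,l+1}$ with $m=\frac12N(N-1)+l$, for $l=1,\dots,N-1$; - $X_m=S_{qp}$ with $m=N^2-\frac{(N+q-1)(N-q)}{2}-p$, for $1\le p<q\le N$. $\mathfrak{h}$ is the Cartan subalgebra of traceless diagonal matrices. For $k=1,\dots,N-1$, $\mathfrak{a}_k=\mathrm{span}\{S_{p,N-k+1}: 1\le p<N-k+1\}$ (matrices whose only nonvanishing entries are above the diagonal in column $N-k+1$), and $\widetilde{\mathfrak{a}}_k=\mathrm{span}\{S_{N-k+1,p}:1\le p<N-k+1\}$ is its Hermitian conjugate. Thus $\mathfrak{sl}(N,\mathbb{C})=\mathfrak{h}\oplus\bigoplus_k\mathfrak{a}_k\oplus\bigoplus_k\widetilde{\mathfrak{a}}_k$, and in the ordered basis the generators of $\mathfrak{a}_1,\dots,\mathfrak{a}_{N-1}$ come first (in this order), then those of $\mathfrak{h}$, then those of $\widetilde{\mathfrak{a}}_{N-1},\dots,\widetilde{\mathfrak{a}}_1$ (in this order). *)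

(* Defs.v *)
From HB Require Import structures.
From mathcomp Require Import all_boot all_order all_algebra.
From mathcomp Require Import complex zify.
From mathcomp Require Import all_classical all_reals all_analysis.

Set Implicit Arguments.
Unset Strict Implicit.
Unset Printing Implicit Defensive.

Import Order.TTheory GRing.Theory Num.Theory.
Import numFieldNormedType.Exports.

Local Open Scope classical_set_scope.
Local Open Scope ring_scope.

(* The library puts the modulus topology on the regular algebra of R[i] only. *)
HB.instance Definition _ (R : realType) := NormedModule.copy R[i] R[i]^o.

Definition mexp (R : realType) (N : nat) (A : 'M[R[i]]_N) : 'M[R[i]]_N :=
  limn (series (fun k : nat => (k`!%:R)^-1 *: A ^+ k)).

(* Derivative relative to I of a curve depending on a real variable: h runs
   over the nonzero reals with t + h in I, so that the derivative is one-sided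
   at an endpoint belonging to I.  If I is reduced to the point t there is no
   such h, and every l qualifies. *)
Definition is_derive_within (R : realType) (p q : nat) (I : set R)
    (f : R -> 'M[R[i]]_(p, q)) (t : R) (l : 'M[R[i]]_(p, q)) : Prop :=
  (h%:C%C)^-1 *: (f (t + h) - f t) @[h --> within [set h | I (t + h)] 0^'] --> l.

(* Positions in the ordered basis X_1, ..., X_(N^2-1) of sl(N); all the
   indices here are counted from 1. *)
Definition upper_pos (N p q : nat) : nat :=
  (((N + q - 1) * (N - q))./2 + p)%N.

Definition diag_pos (N l : nat) : nat := ((N * (N - 1))./2 + l)%N.

Definition lower_pos (N p q : nat) : nat :=
  (N ^ 2 - ((N + q - 1) * (N - q))./2 - p)%N.

(* X_(m+1): ordinals count from 0, hence the successors.  At most one test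
   succeeds, for one pair only: see sl_basis_upper, sl_basis_diag and
   sl_basis_lower below. *)
Definition sl_basis (R : realType) (N : nat) (m : 'I_(N ^ 2 - 1)) : 'M[R[i]]_N :=
  if [pick x : 'I_N * 'I_N | (x.1 < x.2)%N
        && (m.+1 == upper_pos N x.1.+1 x.2.+1)] is Some x
  then delta_mx x.1 x.2
  else if [pick x : 'I_N * 'I_N | (x.2 == x.1.+1 :> nat)
        && (m.+1 == diag_pos N x.1.+1)] is Some x
  then delta_mx x.1 x.1 - delta_mx x.2 x.2
  else if [pick x : 'I_N * 'I_N | (x.1 < x.2)%N
        && (m.+1 == lower_pos N x.1.+1 x.2.+1)] is Some x
  then delta_mx x.2 x.1
  else 0.

Lemma bin2_sqr n : ('C(n, 2) * 2 + n = n ^ 2)%N.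
Proof.
by elim: n => [//|n]; rewrite binS bin1 !expnS !expn0; lia.
Qed.

Lemma bin2_lt q q' : (q < q')%N -> ('C(q, 2) + q <= 'C(q', 2))%N.
Proof. by move=> /(leq_bin2l 2); rewrite binS bin1. Qed.

Lemma half_posE N q : (0 < q <= N)%N ->
  (((N + q - 1) * (N - q))./2 + 'C(q, 2) = 'C(N, 2))%N.
Proof.
move=> /andP[q0 qN]; have hle := leq_bin2l 2 qN.
have -> : ((N + q - 1) * (N - q) = ('C(N, 2) - 'C(q, 2)).*2)%N.
  have [e hN] : {e | N = q + e}%N by exists (N - q)%N; rewrite subnKC.
  move: hle (bin2_sqr N) (bin2_sqr q); move: 'C(N, 2) 'C(q, 2) => x y.
  by rewrite {}hN; nia.
by rewrite doubleK subnK.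
Qed.

Lemma half_diagE N : ((N * (N - 1))./2 = 'C(N, 2))%N.
Proof. by rewrite bin2 subn1. Qed.

Lemma upper_pos_bounds N p q : (0 < p < q)%N -> (q <= N)%N ->
  (0 < upper_pos N p q <= 'C(N, 2))%N.
Proof.
move=> hp hq; have := @half_posE N q ltac:(lia).
rewrite /upper_pos; move: (_./2) => x.
by have := @bin2_lt q.-1 q ltac:(lia); lia.
Qed.

Lemma upper_pos_inj N p q p' q' : (0 < p < q)%N -> (q <= N)%N ->
  (0 < p' < q')%N -> (q' <= N)%N ->
  upper_pos N p q = upper_pos N p' q' -> p = p' /\ q = q'.
Proof.
rewrite /upper_pos => hp hq hp' hq'.
have := @half_posE N q ltac:(lia); have := @half_posE N q' ltac:(lia).
have [hlt|hlt|->] := ssrnat.ltngtP q q'; last by move=> _ _ /addnI.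
- have h1 := @bin2_lt q'.-1 q' ltac:(lia).
  have h2 : ('C(q, 2) <= 'C(q'.-1, 2))%N by apply: leq_bin2l; lia.
  by move: (_./2) (_./2) => x y; lia.
- have h1 := @bin2_lt q.-1 q ltac:(lia).
  have h2 : ('C(q', 2) <= 'C(q.-1, 2))%N by apply: leq_bin2l; lia.
  by move: (_./2) (_./2) => x y; lia.
Qed.

Lemma lower_posE N p q : (0 < p < q)%N -> (q <= N)%N ->
  (lower_pos N p q + upper_pos N p q = N ^ 2)%N.
Proof.
move=> hp hq; have := upper_pos_bounds hp hq.
rewrite /lower_pos /upper_pos -subnDA; have := bin2_sqr N.
by move: (_./2) (N ^ 2)%N => x y; lia.
Qed.

Lemma lower_pos_gt N p q : (0 < p < q)%N -> (q <= N)%N ->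
  ('C(N, 2) + N <= lower_pos N p q)%N.
Proof.
move=> hp hq; have := upper_pos_bounds hp hq.
have := lower_posE hp hq; have := bin2_sqr N.
by move: (N ^ 2)%N => y; lia.
Qed.

Section SlBasis.
Context (R : realType) (N : nat) (m : 'I_(N ^ 2 - 1)).

Lemma sl_basis_upper (p q : 'I_N) : (p < q)%N ->
  m.+1 = upper_pos N p.+1 q.+1 -> sl_basis R m = delta_mx p q.
Proof.
move=> pq hm; rewrite /sl_basis; case: pickP => [[p' q'] /= /andP[pq' /eqP hm']|].
  by have [/succn_inj/val_inj -> /succn_inj/val_inj ->] :=
    @upper_pos_inj N p'.+1 q'.+1 p.+1 q.+1 ltac:(lia) (ltn_ord q')
      ltac:(lia) (ltn_ord q) ltac:(lia).
by move=> /(_ (p, q)) /=; rewrite pq hm eqxx.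
Qed.

Lemma sl_basis_diag (l l' : 'I_N) : l' = l.+1 :> nat ->
  m.+1 = diag_pos N l.+1 -> sl_basis R m = delta_mx l l - delta_mx l' l'.
Proof.
move=> ll hm; rewrite /sl_basis; case: pickP => [[p q] /= /andP[pq /eqP]|_].
  have := @upper_pos_bounds N p.+1 q.+1 ltac:(lia) (ltn_ord q).
  by rewrite hm /diag_pos half_diagE; lia.
case: pickP => [[p q] /= /andP[/eqP pq /eqP]|].
  rewrite hm => /addnI/succn_inj/val_inj lp.
  by have <- : q = l'; rewrite ?lp//; apply/val_inj; rewrite /= pq ll lp.
by move=> /(_ (l, l')) /=; rewrite ll hm !eqxx.
Qed.

Lemma sl_basis_lower (p q : 'I_N) : (p < q)%N ->
  m.+1 = lower_pos N p.+1 q.+1 -> sl_basis R m = delta_mx q p.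
Proof.
move=> pq hm; have hlow := @lower_pos_gt N p.+1 q.+1 ltac:(lia) (ltn_ord q).
rewrite /sl_basis; case: pickP => [[p' q'] /= /andP[pq' /eqP]|_].
  have := @upper_pos_bounds N p'.+1 q'.+1 ltac:(lia) (ltn_ord q').
  by have := ltn_ord q; lia.
case: pickP => [[p' q'] /= /andP[/eqP pq' /eqP]|_].
  by have := ltn_ord q'; rewrite /diag_pos half_diagE; lia.
case: pickP => [[p' q'] /= /andP[pq' /eqP hm']|].
  have h1 := @lower_posE N p.+1 q.+1 ltac:(lia) (ltn_ord q).
  have h2 := @lower_posE N p'.+1 q'.+1 ltac:(lia) (ltn_ord q').
  by have [/succn_inj/val_inj -> /succn_inj/val_inj ->] :=
    @upper_pos_inj N p'.+1 q'.+1 p.+1 q.+1 ltac:(lia) (ltn_ord q')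
      ltac:(lia) (ltn_ord q) ltac:(lia).
by move=> /(_ (p, q)) /=; rewrite pq hm eqxx.
Qed.

End SlBasis.

(* k : 'I_N.-1 stands for the k.+1-th of the N - 1 blocks.  Thus a_k is column
   q = N - k of the upper triangle (counted from 1), its i-th coordinate being
   that of S_(i.+1, N - k). *)
Lemma upper_idx_proof (N : nat) (k : 'I_N.-1) (i : 'I_(N - k.+1)) :
  ((upper_pos N i.+1 (N - k)).-1 < N ^ 2 - 1)%N.
Proof.
have hk := ltn_ord k; have hi := ltn_ord i.
have := @upper_pos_bounds N i.+1 (N - k) ltac:(lia) ltac:(lia).
by have := bin2_sqr N; move: (N ^ 2)%N => y; lia.
Qed.

Definition upper_idx (N : nat) (k : 'I_N.-1) (i : 'I_(N - k.+1)) :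
  'I_(N ^ 2 - 1) := Ordinal (upper_idx_proof i).

Lemma diag_idx_proof (N : nat) (l : 'I_N.-1) :
  ((diag_pos N l.+1).-1 < N ^ 2 - 1)%N.
Proof.
have hl := ltn_ord l; rewrite /diag_pos half_diagE.
have := bin2_sqr N; have := @bin2_lt N.-1 N ltac:(lia).
by move: (N ^ 2)%N => y; lia.
Qed.

Definition diag_idx (N : nat) (l : 'I_N.-1) : 'I_(N ^ 2 - 1) :=
  Ordinal (diag_idx_proof l).

(* Within the conjugate block (row N - k of the lower triangle) the generators
   S_(N - k, p) appear in the ordered basis by decreasing p, from N - k - 1
   down to 1; coordinates are listed in the order of the basis. *)
Lemma lower_idx_proof (N : nat) (k : 'I_N.-1) (i : 'I_(N - k.+1)) :
  ((lower_pos N (N - k.+1 - i) (N - k)).-1 < N ^ 2 - 1)%N.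
Proof.
have hk := ltn_ord k; have hi := ltn_ord i.
have hp : (0 < N - k.+1 - i < N - k)%N by lia.
have := lower_posE hp (leq_subr _ _); have := upper_pos_bounds hp (leq_subr _ _).
have := bin2_sqr N; have := @bin2_lt N.-1 N ltac:(lia).
by move: (N ^ 2)%N => y; lia.
Qed.

Definition lower_idx (N : nat) (k : 'I_N.-1) (i : 'I_(N - k.+1)) :
  'I_(N ^ 2 - 1) := Ordinal (lower_idx_proof i).

Section Blocks.
Context (R : realType) (N : nat).

Definition ublock (k : 'I_N.-1) (u : 'cV[R[i]]_(N ^ 2 - 1)) :
  'cV[R[i]]_(N - k.+1) := \col_i u (upper_idx i) 0.

Definition vblock (u : 'cV[R[i]]_(N ^ 2 - 1)) : 'cV[R[i]]_N.-1 :=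
  \col_l u (diag_idx l) 0.

Definition utblock (k : 'I_N.-1) (u : 'cV[R[i]]_(N ^ 2 - 1)) :
  'cV[R[i]]_(N - k.+1) := \col_i u (lower_idx i) 0.

(* Families of blocks with index < k, with index > k, and with any index: the
   domains of the coefficient functions, which cannot depend on any other
   block. *)
Definition blocks_lt (k : 'I_N.-1) : Type :=
  forall l : 'I_N.-1, (l < k)%N -> 'cV[R[i]]_(N - l.+1).

Definition blocks_gt (k : 'I_N.-1) : Type :=
  forall l : 'I_N.-1, (k < l)%N -> 'cV[R[i]]_(N - l.+1).

Definition blocks_all : Type := forall l : 'I_N.-1, 'cV[R[i]]_(N - l.+1).

Definition ublocks_lt (k : 'I_N.-1) (u : 'cV[R[i]]_(N ^ 2 - 1)) :
  blocks_lt k := fun l _ => ublock l u.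

Definition ublocks (u : 'cV[R[i]]_(N ^ 2 - 1)) : blocks_all :=
  fun l => ublock l u.

Definition utblocks_gt (k : 'I_N.-1) (u : 'cV[R[i]]_(N ^ 2 - 1)) :
  blocks_gt k := fun l _ => utblock l u.

Definition sl_comb (a : 'cV[R[i]]_(N ^ 2 - 1)) : 'M[R[i]]_N :=
  \sum_(m < N ^ 2 - 1) a m 0 *: sl_basis R m.

Definition exp_prod (u : 'cV[R[i]]_(N ^ 2 - 1)) : 'M[R[i]]_N :=
  \prod_(m < N ^ 2 - 1) mexp (u m 0 *: sl_basis R m).

End Blocks.

Arguments blocks_lt R {N} k.
Arguments blocks_gt R {N} k.
Arguments ublocks_lt {R N} k u.
Arguments utblocks_gt {R N} k u.

(* Main.v *)
(* In the upper part of the ordered basis, X_m X_m' = 0 as soon as m <= m', and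
   likewise in the lower part.  Hence the product of exponentials collapses to
   K = U H L, where U and L are the unitriangular matrices 1 + up Z and
   1 + low Z for Z = sum_m u_m X_m, and H is the diagonal matrix of the
   exponentials of the diagonal generators.  Multiplying K' = M K by U^-1 on the
   left and by L^-1 H^-1 on the right gives
     U^-1 U' + H' H^-1 + H L' L^-1 H^-1 = Y,   Y = U^-1 M U,
   whose three terms are strictly upper triangular, diagonal and strictly lower
   triangular.  Thus U' = U (up Y), H' = (dg Y) H and L' = H^-1 (low Y) H L.
   Writing U = A (1 + x) B, where x is column q and A (resp. B) collects the
   columns to its right (resp. left), column q of U (up Y) only depends on
   T = A^-1 M A and is quadratic in x: it is the part above q of
   (1 - x) T (1 + x) e_q.  The traces of M and Z vanish, which makes up for the
   diagonal equations being one more than the unknowns v.  Row q of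
   H^-1 (low Y) H L only involves the rows of L above q, so that the linear
   equations hold with D = 0.

   At a point where the derivative is vacuous (I reduced to it) both sides hold;
   elsewhere limits are unique and the equivalence is the algebraic one above. *)

Require Import Defs.
From mathcomp Require Import all_boot all_order all_algebra.
From mathcomp Require Import complex ring zify.
From mathcomp Require Import all_classical all_reals all_analysis.

Set Implicit Arguments.
Unset Strict Implicit.
Unset Printing Implicit Defensive.

Import Order.TTheory GRing.Theory Num.Theory.
Import numFieldNormedType.Exports.

Local Open Scope classical_set_scope.
Local Open Scope ring_scope.

(** * Convergence in R[i] and the complex exponential *)

(** A neighbourhood of a matrix contains a product of neighbourhoods of its entries; there are
    finitely many of them, and filters are stable under finite intersections. *)
Lemma cvg_mxP (T : topologicalType) (X : Type) (F : set_system X)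
    {FF : Filter F} (m n : nat) (f : X -> 'M[T]_(m, n)) (A : 'M[T]_(m, n)) :
  f x @[x --> F] --> A <-> forall i j, f x i j @[x --> F] --> A i j.
Proof.
split=> [fA i j B AB|fA B [P AP sPB]].
  apply: (fA [set M | B (M i j)]).
  (* Only entry [(i, j)] is constrained; elsewhere the set is the whole space. *)
  exists (fun i' j' => [set z | i' = i -> j' = j -> B z]).
    move=> i' j'; have [->|ni] := pselect (i' = i); last first.
      by apply: filterS filterT => z _ /ni.
    have [->|nj] := pselect (j' = j); last first.
      by apply: filterS filterT => z _ _ /nj.
    by apply: (filterS _ AB) => z Bz _ _.
  by move=> M; apply.
apply: (@filterS _ F FF (fun x => forall ij : 'I_m * 'I_n, P ij.1 ij.2 (f x ij.1 ij.2))).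
  by move=> x Px; apply: sPB => i j; exact: (Px (i, j)).
by apply: filter_forall => -[i j]; apply: fA; exact: AP.
Qed.

Section ComplexExponential.
Context (R : realType).
Implicit Types (z w : R[i]).

Lemma complex_hausdorff : hausdorff_space R[i].
Proof. exact: (@norm_hausdorff R[i] R[i]). Qed.

(** A positive element of [R[i]] is real and the embedding of [R] preserves the modulus, so radii
    can be taken in [R]. *)
Lemma cvg_real_complex (T : Type) (F : set_system T) {FF : Filter F}
    (f : T -> R) (l : R) :
  f x @[x --> F] --> l -> (f x)%:C%C @[x --> F] --> l%:C%C.
Proof.
move=> fl; apply/(@cvgrPdist_lt R[i] R[i]) => e e0.
have er : e = (complex.Re e)%:C%C by rewrite RRe_real// gtr0_real.
have {}e0 : 0 < complex.Re e by rewrite -ltcR -er.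
move/cvgrPdist_lt/(_ _ e0): fl; apply: filterS => x.
by rewrite -rmorphB/= er normc_def/= expr0n addr0 sqrtr_sqr ltcR.
Qed.

Lemma cvg0_norm_le (T : Type) (F : set_system T) {FF : Filter F}
    (f g : T -> R[i]) :
  (\forall x \near F, `|f x| <= g x) -> g x @[x --> F] --> (0 : R[i]) ->
  f x @[x --> F] --> (0 : R[i]).
Proof.
move=> fg /(@cvgr0Pnorm_lt R[i] R[i]) g0; apply/(@cvgr0Pnorm_lt R[i] R[i]) => e e0.
have := g0 _ e0; move: fg; apply: filterS2 => x fg.
by apply: le_lt_trans; rewrite (ger0_norm (le_trans (normr_ge0 (f x)) fg)).
Qed.

Lemma complex_cvg_unique (T : Type) (F : set_system T) {FF : ProperFilter F}
    (f : T -> R[i]) (a b : R[i]) :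
  f x @[x --> F] --> a -> f x @[x --> F] --> b -> a = b.
Proof. by move=> fa fb; apply: (cvg_unique complex_hausdorff fa fb). Qed.

Lemma cvg_norm_le (T : Type) (F : set_system T) {FF : ProperFilter F}
    (f g : T -> R[i]) (l m : R[i]) :
  f x @[x --> F] --> l -> g x @[x --> F] --> m ->
  (\forall x \near F, `|f x| <= g x) -> `|l| <= m.
Proof.
move=> fl gm fg.
have gfl : g x - `|f x| @[x --> F] --> m - `|l|.
  apply: (@cvgB R[i] R[i]); first exact: gm.
  by apply: (@cvg_norm R[i] R[i]); exact: fl.
(* The order on [R[i]] is partial: positivity of the limit [r] is read off
   [`|r| = r], which passes to the limit. *)
set r : R[i] := m - `|l|.
pose d (x : T) : R[i] := `|g x - `|f x| | - (g x - `|f x|).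
have c0 : d x @[x --> F] --> (0 : R[i]).
  apply: cvg_near_cst; apply: filterS fg => x.
  by rewrite /d -subr_ge0 => /ger0_norm ->; rewrite subrr.
have cr : d x @[x --> F] --> (`|r| - r : R[i]).
  apply: (@cvgB R[i] R[i]); last exact: gfl.
  by apply: (@cvg_norm R[i] R[i]); exact: gfl.
have e : `|r| = r := subr0_eq (complex_cvg_unique cr c0).
by rewrite -subr_ge0 -/r -e.
Qed.

Definition cexp_series z : R[i]^nat := series (fun k : nat => (k`!%:R)^-1 * z ^+ k).

(** A limit of partial sums, in the same form as [mexp], so that [mexp] of a diagonal matrix is
    computed entrywise. *)
Definition cexp z : R[i] := limn (cexp_series z).

Lemma cexp_seriesE z n : cexp_series z n = \sum_(k < n) (k`!%:R)^-1 * z ^+ k.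
Proof. by rewrite /cexp_series seriesEord. Qed.

Lemma cexp_series_real (x : R) n :
  cexp_series x%:C%C n = (series (exp_coeff x) n)%:C%C.
Proof.
rewrite cexp_seriesE seriesEord rmorph_sum; apply: eq_bigr => k _.
by rewrite /exp_coeff/= rmorphM rmorphXn fmorphV rmorph_nat mulrC.
Qed.

Lemma cvg_series_exp (x : R) : series (exp_coeff x) @ \oo --> expR x.
Proof. exact: is_cvg_series_exp_coeff. Qed.

Lemma cvg_cexp_series_real (x : R) : cexp_series x%:C%C @ \oo --> (expR x)%:C%C.
Proof.
rewrite (_ : cexp_series _ = fun n => (series (exp_coeff x) n)%:C%C).
  by apply: cvg_real_complex; exact: (@cvg_series_exp).
by apply/funext => n; exact: cexp_series_real.
Qed.

(** The series of real parts and of imaginary parts are both dominated by the real exponential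
    series at the modulus of [z]; their limits are then recombined. *)
Lemma cvg_cexp_series z : cexp_series z @ \oo --> cexp z.
Proof.
have nzE : `|z| = (complex.Re `|z|)%:C%C by rewrite RRe_real// normr_real.
have dom (p : R[i] -> R) : (forall w, `|p w|%:C%C <= `|w|) ->
    cvgn (series (fun k : nat => p ((k`!%:R)^-1 * z ^+ k))).
  move=> ple; apply: normed_cvg.
  apply: (@series_le_cvg _ _ (exp_coeff (complex.Re `|z|))).
  - by move=> k /=; exact: normr_ge0.
  - by move=> k; apply: exp_coeff_ge0; rewrite -lecR -nzE normr_ge0.
  - move=> k /=; rewrite -lecR; apply: le_trans (ple _) _.
    rewrite normrM normrX normfV normr_nat nzE /exp_coeff/=.
    by rewrite rmorphM rmorphXn fmorphV rmorph_nat mulrC.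
  - exact: is_cvg_series_exp_coeff.
have leRe w : `|complex.Re w|%:C%C <= `|w|.
  by rewrite normc_def lecR -sqrtr_sqr ler_wsqrtr// lerDl sqr_ge0.
have leIm w : `|complex.Im w|%:C%C <= `|w|.
  by rewrite normc_def lecR -sqrtr_sqr ler_wsqrtr// lerDr sqr_ge0.
have cRe := dom _ leRe; have cIm := dom _ leIm.
apply/cvg_ex; eexists.
rewrite (_ : cexp_series z = fun n =>
  (series (fun k : nat => complex.Re ((k`!%:R)^-1 * z ^+ k)) n)%:C%C +
  'i%C * (series (fun k : nat => complex.Im ((k`!%:R)^-1 * z ^+ k)) n)%:C%C).
  apply: (@cvgD R[i] R[i]); first exact: cvg_real_complex cRe.
  apply: (@cvgM R[i]); [exact: cvg_cst|exact: cvg_real_complex cIm].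
apply/funext => n; rewrite cexp_seriesE !seriesEord !rmorph_sum mulr_sumr -big_split.
by apply: eq_bigr => k _; exact: complexE.
Qed.

Lemma cexp_real (x : R) : cexp x%:C%C = (expR x)%:C%C.
Proof. exact: complex_cvg_unique (@cvg_cexp_series _) (@cvg_cexp_series_real x). Qed.

Lemma cexp0 : cexp 0 = 1.
Proof. by rewrite -[0]/(0%:C%C) cexp_real expR0. Qed.

(* Both sides count the pairs (i, j) of [0, n[^2 with i + j >= n. *)
Lemma cexp_series_mulB (K : numFieldType) (x y : K) n :
  let e (z : K) := \sum_(k < n) (k`!%:R)^-1 * z ^+ k : K in
  e x * e y - e (x + y) = \sum_(i < n) \sum_(j < n | (n <= i + j)%N)
     (i`!%:R)^-1 * x ^+ i * ((j`!%:R)^-1 * y ^+ j).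
Proof.
move=> e.
have -> : e (x + y) = \sum_(i < n) \sum_(j < n | (i + j < n)%N)
     (i`!%:R)^-1 * x ^+ i * ((j`!%:R)^-1 * y ^+ j).
  have -> : e (x + y) = \sum_(k < n) \sum_(i < n | (i <= k)%N)
      (i`!%:R)^-1 * x ^+ i * (((k - i)`!%:R)^-1 * y ^+ (k - i)).
    apply: eq_bigr => k _; rewrite addrC exprDn mulr_sumr.
    rewrite (big_ord_widen n
      (fun i => (k`!%:R)^-1 * (y ^+ (k - i) * x ^+ i *+ 'C(k, i)))) ?ltn_ord//.
    apply: eq_big => [i|i ik]; first by rewrite ltnS.
    have f0 (m : nat) : m`!%:R != 0 :> K by rewrite pnatr_eq0 -lt0n fact_gt0.
    rewrite ltnS in ik; rewrite -(bin_fact ik) !natrM.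
    rewrite -(mulr_natr (y ^+ (k - i) * x ^+ i)).
    have b0 : 'C(k, i)%:R != 0 :> K by rewrite pnatr_eq0 -lt0n bin_gt0.
    move: (x ^+ i) (y ^+ (k - i)) (f0 i) (f0 (k - i)%N) b0.
    move: (i`!%:R) ((k - i)`!%:R) ('C(k, i)%:R) => a b c X Y a0 b0 c0.
    by field; rewrite a0 b0 c0.
  rewrite (exchange_big_dep predT)//=; apply: eq_bigr => i _.
  rewrite -(big_mkord (fun k => i <= k)%N
    (fun k => (i`!%:R)^-1 * x ^+ i * (((k - i)`!%:R)^-1 * y ^+ (k - i)))).
  rewrite -(big_mkord (fun j => i + j < n)%N
    (fun j => (i`!%:R)^-1 * x ^+ i * ((j`!%:R)^-1 * y ^+ j))).
  (* For fixed [i], the terms [k < i] on the left and [j >= n - i] on the right are excluded by the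
     conditions; what remains matches under [k = i + j]. *)
  rewrite (@big_cat_nat _ _ _ i)//=; last exact: ltnW.
  rewrite big_nat_cond big1 ?add0r; last by move=> k; lia.
  rewrite [RHS](@big_cat_nat _ _ _ (n - i)%N)//=; last exact: leq_subr.
  rewrite [X in _ + X]big_nat_cond [X in _ + X]big1 ?addr0; last by move=> k; lia.
  rewrite -{1}[X in \sum_(X <= _ < _ | _) _](add0n i) big_addn.
  rewrite big_nat_cond [RHS]big_nat_cond; apply: eq_big => [j|j _]; first by lia.
  by rewrite addnK.
rewrite mulr_suml -sumrB; apply: eq_bigr => i _; rewrite mulr_sumr.
rewrite [X in X - _](bigID (fun j : 'I_n => i + j < n)%N)/=.
rewrite [LHS]addrC addKr.
by apply: eq_bigl => j; rewrite -leqNgt.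
Qed.

(** The error of the truncated Cauchy product is bounded in modulus by the same error at the moduli
    of [z] and [w], which tends to 0 because [expR] is already known to turn sums into products. *)
Lemma cexpD z w : cexp (z + w) = cexp z * cexp w.
Proof.
have c1 := @cvg_cexp_series z; have c2 := @cvg_cexp_series w.
have c3 := @cvg_cexp_series (z + w).
set x := complex.Re `|z|; set y := complex.Re `|w|.
have xE : `|z| = x%:C%C by rewrite RRe_real// normr_real.
have yE : `|w| = y%:C%C by rewrite RRe_real// normr_real.
have h : cexp_series z n * cexp_series w n - cexp_series (z + w) n
    @[n --> \oo] --> (0 : R[i]).
  apply: (cvg0_norm_le (g := fun n => cexp_series x%:C%C n * cexp_series y%:C%C n
    - cexp_series (x + y)%:C%C n)).
    apply: nearW => n; rewrite !cexp_seriesE rmorphD !cexp_series_mulB.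
    apply: le_trans (ler_norm_sum _ _ _) _; apply: ler_sum => i _.
    apply: le_trans (ler_norm_sum _ _ _) _; apply: ler_sum => j _.
    by rewrite !normrM !normrX !normfV !normr_nat xE yE.
  rewrite -(subrr (expR (x + y))%:C%C) {1}expRD rmorphM.
  apply: (@cvgB R[i] R[i]); last exact: cvg_cexp_series_real.
  by apply: (@cvgM R[i]); exact: cvg_cexp_series_real.
have h' : cexp_series z n * cexp_series w n - cexp_series (z + w) n
    @[n --> \oo] --> cexp z * cexp w - cexp (z + w).
  apply: (@cvgB R[i] R[i]); last exact: c3.
  by apply: (@cvgM R[i]); [exact: c1|exact: c2].
exact/esym/subr0_eq/(complex_cvg_unique h' h).
Qed.

Lemma cexp_neq0 z : cexp z != 0.
Proof.
have : cexp z * cexp (- z) != 0 by rewrite -cexpD subrr cexp0 oner_eq0.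
by apply: contraNneq => ->; rewrite mul0r.
Qed.

(** Past the terms 1 and [z], the coefficients [1/(k+2)!] are at most [1/k!]. This quadratic bound
    is what differentiates [cexp]. *)
Lemma norm_cexpB1_le z :
  `|cexp z - 1 - z| <= `|z| ^+ 2 * (expR (complex.Re `|z|))%:C%C.
Proof.
set x := complex.Re `|z|.
have xE : `|z| = x%:C%C by rewrite RRe_real// normr_real.
(* The shift by two leaves exactly [n] terms once the first two are removed, to be compared with the
   partial sum of order [n]. *)
have c0 : cexp_series z n.+2 @[n --> \oo] --> cexp z.
  by have := @cvg_cexp_series z; rewrite -cvg_shiftS -cvg_shiftS.
have c1 : (1 + z : R[i]) @[n --> \oo] --> (1 + z : R[i]) by exact: cvg_cst.
have c : cexp_series z n.+2 - (1 + z) @[n --> \oo] --> cexp z - (1 + z).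
  exact: (@cvgB R[i] R[i] _ _ _ _ _ _ _ c0 c1).
rewrite -addrA -opprD.
have c' : `|z| ^+ 2 * cexp_series x%:C%C n @[n --> \oo] --> `|z| ^+ 2 * (expR x)%:C%C.
  by apply: (@cvgM R[i]); [exact: cvg_cst|exact: cvg_cexp_series_real].
apply: (@cvg_norm_le nat \oo _ _ _ _ _ c c').
apply: nearW => n; rewrite !cexp_seriesE !big_ord_recl/= expr0 fact0.
rewrite (_ : _ - (1 + z) = \sum_(i < n) (i.+2`!%:R)^-1 * z ^+ i.+2); last first.
  rewrite /bump/= !addn0 (_ : 1`! = 1)%N// invr1 !mul1r expr1 addrA [LHS]addrC addKr.
  by apply: eq_bigr => k _; rewrite !add1n.
apply: le_trans (ler_norm_sum _ _ _) _; rewrite mulr_sumr; apply: ler_sum => k _.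
rewrite normrM normrX normfV normr_nat xE [leRHS]mulrCA -exprD add2n.
apply: ler_wpM2r; first by rewrite -xE exprn_ge0.
rewrite lef_pV2 ?posrE ?ltr0n ?fact_gt0// ler_nat.
by apply: leq_fact; lia.
Qed.

End ComplexExponential.

(** * Derivatives relative to a set of reals *)

Lemma cvg_near_eq (T : Type) (U : topologicalType) (F : set_system T)
    {FF : Filter F} (f g : T -> U) (l : U) :
  (\forall x \near F, f x = g x) -> g x @[x --> F] --> l -> f x @[x --> F] --> l.
Proof. by move=> fg gl A /gl; move: fg; apply: filterS2 => x /= ->. Qed.

Section DeriveWithin.
Context (R : realType) (I : set R) (t : R).
Local Notation F := (within [set h | I (t + h)] 0^').

(** Scalar counterpart of [is_derive_within]. At an isolated point [F] is improper and every [l]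
    qualifies, whence the [ProperFilter] assumption for uniqueness. *)
Definition has_derive (f : R -> R[i]) (l : R[i]) :=
  (h%:C%C)^-1 * (f (t + h) - f t) @[h --> F] --> l.

Lemma is_derive_withinP (p q : nat) (f : R -> 'M[R[i]]_(p, q)) l :
  is_derive_within I f t l <->
  forall i j, has_derive (fun s => f s i j) (l i j).
Proof.
rewrite /is_derive_within cvg_mxP.
have e i j : (fun h : R => ((h%:C%C)^-1 *: (f (t + h) - f t)) i j) =
    (fun h : R => (h%:C%C)^-1 * (f (t + h) i j - f t i j)).
  by apply/funext => h; rewrite !mxE.
by split=> H i j; have := H i j; rewrite /has_derive e.
Qed.

Lemma has_derive_unique (FF : ProperFilter F) f l l' :
  has_derive f l -> has_derive f l' -> l = l'.
Proof. exact: complex_cvg_unique. Qed.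

Lemma has_derive_cst c : has_derive (fun=> c) 0.
Proof.
rewrite /has_derive; under eq_fun do rewrite subrr mulr0.
exact: cvg_cst.
Qed.

Lemma has_deriveD f g l m : has_derive f l -> has_derive g m ->
  has_derive (fun s => f s + g s) (l + m).
Proof.
move=> fl gm; rewrite /has_derive.
under eq_fun do rewrite opprD addrACA mulrDr.
exact: (@cvgD R[i] R[i] _ _ _ _ _ _ _ fl gm).
Qed.

Lemma cvg_within0 : h%:C%C @[h --> F] --> (0 : R[i]).
Proof.
apply: cvg_real_complex => A A0; apply: filterS A0 => h Ah _ _; exact: Ah.
Qed.

Lemma near_within_neq0 : \forall h \near F, h%:C%C != 0 :> R[i].
Proof.
by apply: (filterS _ (@filterT _ (nbhs (0 : R)) _)) => h _ h0 _; rewrite fmorph_eq0.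
Qed.

(** The increment is [h], which tends to 0, times the convergent difference quotient. *)
Lemma has_derive_cvg f l : has_derive f l -> f (t + h) - f t @[h --> F] --> (0 : R[i]).
Proof.
move=> fl; have H : h%:C%C * ((h%:C%C)^-1 * (f (t + h) - f t)) @[h --> F] --> (0 : R[i]).
  by rewrite -(mul0r l); exact: (@cvgM R[i] _ _ _ _ _ _ _ cvg_within0 fl).
apply: (cvg_near_eq _ H).
by apply: filterS near_within_neq0 => h h0; rewrite /= mulVKf.
Qed.

Lemma has_deriveM f g l m : has_derive f l -> has_derive g m ->
  has_derive (fun s => f s * g s) (l * g t + f t * m).
Proof.
move=> fl gm; rewrite /has_derive.
have ct : g (t + h) @[h --> F] --> g t.
  have H : g (t + h) - g t + g t @[h --> F] --> g t.
    rewrite -[X in _ --> X]add0r; apply: (@cvgD R[i] R[i]); last exact: cvg_cst.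
    exact: (has_derive_cvg gm).
  by apply: (cvg_near_eq _ H); apply: nearW => h; rewrite subrK.
rewrite (_ : (fun h : R => _) = (fun h : R =>
  (h%:C%C)^-1 * (f (t + h) - f t) * g (t + h) +
  f t * ((h%:C%C)^-1 * (g (t + h) - g t)))); last by apply/funext => h; ring.
apply: (@cvgD R[i] R[i]).
  exact: (@cvgM R[i] _ _ _ _ _ _ _ fl ct).
apply: (@cvgM R[i]); [exact: cvg_cst|exact: gm].
Qed.

Lemma has_derive_sum (J : Type) (r : seq J) (P : pred J) (f : J -> R -> R[i]) l :
  (forall j, P j -> has_derive (f j) (l j)) ->
  has_derive (fun s => \sum_(j <- r | P j) f j s) (\sum_(j <- r | P j) l j).
Proof.
move=> fl; elim: r => [|j r IH].
  rewrite big_nil; under [X in has_derive X]eq_fun do rewrite big_nil.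
  exact: has_derive_cst.
rewrite big_cons; under [X in has_derive X]eq_fun do rewrite big_cons.
case: ifPn => Pj; last exact: IH.
exact: (has_deriveD (fl _ Pj) IH).
Qed.

Lemma has_deriveZ c f l : has_derive f l -> has_derive (fun s => f s * c) (l * c).
Proof.
move=> fl; have := has_deriveM fl (has_derive_cst c).
by rewrite mulr0 addr0.
Qed.

(** By [cexpD], the increment of [cexp] along [f] is [cexp (f t)] times [cexp (d h) - 1], that is,
    [d h] plus a remainder quadratic in [d h]. *)
Lemma has_derive_cexp f l : has_derive f l ->
  has_derive (fun s => cexp (f s)) (cexp (f t) * l).
Proof.
move=> fl; rewrite /has_derive.
set d := fun h : R => f (t + h) - f t.
rewrite (_ : (fun h : R => _) = (fun h : R => cexp (f t) *
    ((h%:C%C)^-1 * d h + (h%:C%C)^-1 * (cexp (d h) - 1 - d h)))); last first.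
  apply/funext => h; have -> : cexp (f (t + h)) = cexp (d h) * cexp (f t).
    by rewrite -cexpD subrK.
  have splitE (K : comPzRingType) (a b c x : K) :
      x * (a * b - b) = b * (x * c + x * (a - 1 - c)) by ring.
  exact: splitE.
have -> : cexp (f t) * l = cexp (f t) * (l + 0) by rewrite addr0.
apply: (@cvgM R[i]); first exact: cvg_cst.
apply: (@cvgD R[i] R[i]); first exact: fl.
(* Bound for the remainder divided by [h], valid once [d h] has modulus below 1: a factor tending to
   the modulus of [l], one tending to 0, and the constant [expR 1]. *)
have cb : `|(h%:C%C)^-1 * d h| * `|d h| * (expR 1)%:C%C @[h --> F] --> (0 : R[i]).
  have -> : 0 = `|l| * `|0 : R[i]| * (expR 1)%:C%C by rewrite normr0 mulr0 mul0r.
  apply: (@cvgM R[i]); last exact: cvg_cst.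
  apply: (@cvgM R[i]); apply: (@cvg_norm R[i] R[i]); first exact: fl.
  exact: has_derive_cvg fl.
apply: (cvg0_norm_le _ cb).
have d1 : \forall h \near F, `|d h| < 1.
  by have /(@cvgr0Pnorm_lt R[i] R[i]) := has_derive_cvg fl; apply.
apply: filterS d1 => h dh1.
apply: le_trans (_ : `|(h%:C%C)^-1| *
  (`|d h| ^+ 2 * (expR (complex.Re `|d h|))%:C%C) <= _).
  by rewrite normrM ler_wpM2l//; exact: norm_cexpB1_le.
rewrite normrM expr2 !mulrA; apply: ler_wpM2l; first by rewrite !mulr_ge0.
rewrite lecR ler_expR -lecR RRe_real ?normr_real//; exact: ltW.
Qed.

End DeriveWithin.

(** * Exponentials of square-zero and of diagonal matrices *)

Section MatrixExponential.
Context (R : realType) (N : nat).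
Implicit Types A B : 'M[R[i]]_N.

Lemma mexpP A B : series (fun k : nat => (k`!%:R)^-1 *: A ^+ k) @ \oo --> B ->
  mexp A = B.
Proof. by move=> AB; apply: cvg_lim => //; exact: (@norm_hausdorff R[i] 'M[R[i]]_N). Qed.

(** The partial sums are stationary as soon as they have two terms. *)
Lemma mexp_sq0 A : A *m A = 0 -> mexp A = 1%:M + A.
Proof.
move=> A2; apply: mexpP; apply: cvg_near_cst; exists 2%N => // -[|[|n]]//= _.
rewrite seriesEord /= big_ord_recl big_ord_recl big1 ?addr0 => [|k _].
  by rewrite /= fact0 expr0 expr1 invr1 !scale1r.
by rewrite -[A ^+ _]/(A ^+ k.+2) !exprS mulrA -[A * A]/(A *m A) A2 mul0r scaler0.
Qed.

Lemma diag_mxX (d : 'rV[R[i]]_N) k :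
  diag_mx d ^+ k = diag_mx (\row_i (d 0 i ^+ k)).
Proof.
elim: k => [|k IH].
  rewrite expr0 (_ : \row_i _ = const_mx 1) ?diag_const_mx//.
  by apply/rowP => i; rewrite !mxE expr0.
rewrite exprS IH -[_ * _]/(_ *m _) mulmx_diag; congr diag_mx.
by apply/rowP => i; rewrite !mxE exprS.
Qed.

Lemma mexp_diag (d : 'rV[R[i]]_N) :
  mexp (diag_mx d) = diag_mx (\row_i cexp (d 0 i)).
Proof.
apply: mexpP; apply/cvg_mxP => i j; rewrite [X in _ --> X]mxE [X in _ --> X *+ _]mxE.
have -> : (fun n : nat => series (fun k : nat => (k`!%:R)^-1 *: diag_mx d ^+ k) n i j) =
    (fun n => cexp_series (d 0 i) n *+ (i == j)).
  apply/funext => n; rewrite seriesEord summxE cexp_seriesE -sumrMnl.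
  by apply: eq_bigr => k _; rewrite diag_mxX !mxE mulrnAr.
case: eqP => _; first exact: (@cvg_cexp_series R).
exact: cvg_cst.
Qed.

End MatrixExponential.

(** * Triangular factorization of the equation *)

Definition up (V : nmodType) (N : nat) (A : 'M[V]_N) : 'M[V]_N :=
  \matrix_(i, j) (A i j *+ (i < j)%N).
Definition low (V : nmodType) (N : nat) (A : 'M[V]_N) : 'M[V]_N :=
  \matrix_(i, j) (A i j *+ (j < i)%N).
Definition dg (V : nmodType) (N : nat) (A : 'M[V]_N) : 'M[V]_N :=
  diag_mx (\row_i A i i).

Section Triangular.
Context (K : fieldType) (N : nat).
Implicit Types (A M U L W X Y Z : 'M[K]_N) (h : 'rV[K]_N).

Definition strict_upper X := forall i j : 'I_N, (j <= i)%N -> X i j = 0.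
Definition strict_lower X := forall i j : 'I_N, (i <= j)%N -> X i j = 0.

Lemma strict_upper_up X : strict_upper (up X).
Proof. by move=> i j ji; rewrite mxE ltnNge ji. Qed.

Lemma strict_lower_low X : strict_lower (low X).
Proof. by move=> i j ij; rewrite mxE ltnNge ij. Qed.

Lemma strict_upperB X Y : strict_upper X -> strict_upper Y -> strict_upper (X - Y).
Proof. by move=> hX hY i j ij; rewrite !mxE hX// hY// subrr. Qed.

Lemma strict_lowerB X Y : strict_lower X -> strict_lower Y -> strict_lower (X - Y).
Proof. by move=> hX hY i j ij; rewrite !mxE hX// hY// subrr. Qed.

Lemma unitri_mul_up W X i j :
  ((1%:M + up W) *m X) i j = X i j + \sum_(p : 'I_N | (i < p)%N) W i p * X p j.
Proof.
rewrite mulmxDl mul1mx [LHS]mxE; congr (_ + _); rewrite mxE [RHS]big_mkcond.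
by apply: eq_bigr => p _; rewrite mxE; case: ifP; rewrite ?mulr1n// mulr0n mul0r.
Qed.

Lemma strict_upper_mul W X : strict_upper X -> strict_upper ((1%:M + up W) *m X).
Proof.
move=> hX i j ji; rewrite unitri_mul_up hX// add0r big1// => p ip.
by rewrite hX ?mulr0//; lia.
Qed.

(** Induction on rows from the bottom: row [i] of the product is row [i] of [X] plus a combination
    of lower rows, already known to vanish in column [j <= i]. No description of the inverse of a
    unitriangular matrix is required. *)
Lemma strict_upper_cancel W X : strict_upper ((1%:M + up W) *m X) -> strict_upper X.
Proof.
move=> h i j; have [e] := ubnP (N - i); elim: e i => // e IH i ei ji.
have := h i j ji; rewrite unitri_mul_up big1 ?addr0// => p ip.
by rewrite IH ?mulr0//; have := ltn_ord p; lia.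
Qed.

Lemma tr_unitri_low W : (1%:M + low W)^T = 1%:M + up W^T.
Proof. by apply/matrixP => i j; rewrite !mxE eq_sym. Qed.

Lemma strict_lower_tr X : strict_lower X <-> strict_upper X^T.
Proof. by split=> h i j ij; [rewrite mxE h|have := h j i ij; rewrite mxE]. Qed.

Lemma strict_lower_mul W X : strict_lower X -> strict_lower (X *m (1%:M + low W)).
Proof.
by rewrite !strict_lower_tr trmx_mul tr_unitri_low; exact: strict_upper_mul.
Qed.

Lemma strict_lower_cancel W X : strict_lower (X *m (1%:M + low W)) -> strict_lower X.
Proof.
by rewrite !strict_lower_tr trmx_mul tr_unitri_low; exact: strict_upper_cancel.
Qed.

Lemma unitri_low_unit W : 1%:M + low W \in unitmx.
Proof.
rewrite unitmxE det_trig.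
  by rewrite big1 ?unitr1// => i _; rewrite !mxE eqxx ltnn addr0.
by apply/is_trig_mxP => i j ij; rewrite !mxE ltnNge ltnW// -val_eqE/= ltn_eqF// addr0.
Qed.

Lemma unitri_up_unit W : 1%:M + up W \in unitmx.
Proof. by rewrite -unitmx_tr -[W]trmxK -tr_unitri_low trmxK unitri_low_unit. Qed.

Lemma split_up_dg_low Y : Y = up Y + dg Y + low Y.
Proof.
apply/matrixP => i j; rewrite !mxE -val_eqE/=.
by case: (ssrnat.ltngtP i j) => [_|_|/val_inj ->];
  rewrite ?addr0 ?add0r ?mulr0n ?mulr1n ?addr0 ?add0r.
Qed.

(** The three summands have disjoint supports, so each entry of the equation is a single entry of
    [A], [B] or [C] times a nonzero [h 0 i]. *)
Lemma upper_dg_lower_eq0 A (B C : 'M[K]_N) h :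
  strict_upper A -> (forall i j, i != j -> B i j = 0) -> strict_lower C ->
  (forall i, h 0 i != 0) ->
  A *m diag_mx h + B *m diag_mx h + diag_mx h *m C = 0 -> [/\ A = 0, B = 0 & C = 0].
Proof.
move=> hA hB hC h0 e.
have E i j : A i j * h 0 j + B i j * h 0 j + h 0 i * C i j = 0.
  by move/matrixP: e => /(_ i j); rewrite !mul_mx_diag mul_diag_mx !mxE.
split; apply/matrixP => i j; rewrite mxE.
- have [ji|ij] := leqP j i; first exact: hA.
  have := E i j; rewrite hB ?hC ?mul0r ?mulr0 ?addr0//; last 2 first.
  + exact: ltnW.
  + by rewrite -val_eqE/= ltn_eqF.
  by move/eqP; rewrite mulf_eq0 (negPf (h0 j)) orbF => /eqP.
- have [<-|ij] := eqVneq i j; last exact: hB.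
  have := E i i; rewrite hA ?hC ?mul0r ?mulr0 ?addr0 ?add0r//.
  by move/eqP; rewrite mulf_eq0 (negPf (h0 i)) orbF => /eqP.
- have [ij|ji] := leqP i j; first exact: hC.
  have := E i j; rewrite hB ?hA ?mul0r ?mulr0 ?addr0 ?add0r//; last 2 first.
  + exact: ltnW.
  + by rewrite -val_eqE/= gtn_eqF.
  by move/eqP; rewrite mulf_eq0 (negPf (h0 i)) => /eqP.
Qed.

(* Left-hand side of the equivalence: the derivative of [U H L] when
   [U' = up Z], [H' = dg Z * H] and [L' = low Z]. *)
Lemma factored_ode W W' Y Z h : (forall i, h 0 i != 0) ->
  let U := 1%:M + up W in let L := 1%:M + low W' in let H := diag_mx h in
  let Hi := diag_mx (\row_i (h 0 i)^-1) in
  up Z *m H *m L + U *m (dg Z *m H) *m L + U *m H *m low Z = U *m Y *m H *m L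
  <-> [/\ up Z = U *m up Y, dg Z = dg Y & low Z = Hi *m low Y *m H *m L].
Proof.
move=> h0 U L H Hi.
have HHi : H *m Hi = 1%:M.
  rewrite mulmx_diag -diag_const_mx; congr diag_mx.
  by apply/rowP => i; rewrite !mxE mulfV.
have HiH : Hi *m H = 1%:M.
  rewrite mulmx_diag -diag_const_mx; congr diag_mx.
  by apply/rowP => i; rewrite !mxE mulVf.
have Uu : U \in unitmx := unitri_up_unit W.
have Lu : L \in unitmx := unitri_low_unit W'.
have mulU X : strict_upper X -> strict_upper (U *m X) := @strict_upper_mul W X.
have cancelU X : strict_upper (U *m X) -> strict_upper X := @strict_upper_cancel W X.
have mulL X : strict_lower X -> strict_lower (X *m L) := @strict_lower_mul W' X.
have cancelL X : strict_lower (X *m L) -> strict_lower X := @strict_lower_cancel W' X.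
have sHi : strict_lower (Hi *m low Y *m H).
  move=> i j ij; rewrite mul_mx_diag mul_diag_mx !mxE.
  by rewrite ltnNge ij mulr0 mul0r.
have HE : H = diag_mx h by [].
clearbody U L H Hi.
have eY : U *m Y *m H *m L = U *m up Y *m H *m L + U *m (dg Y *m H) *m L +
    U *m H *m (Hi *m low Y *m H *m L).
  rewrite {1}(split_up_dg_low Y) !mulmxDr !mulmxDl !mulmxA.
  by rewrite -(mulmxA U H Hi) HHi mulmx1.
split; last by case=> -> -> ->; rewrite eY.
rewrite eY => e.
(* Differences of corresponding terms, freed from [U] and [L]; by the cancellation lemmas [A] and
   [C] stay strictly triangular. *)
pose A := invmx U *m (up Z - U *m up Y).
pose B := dg Z - dg Y.
pose C := (low Z - Hi *m low Y *m H *m L) *m invmx L.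
have UA : U *m A = up Z - U *m up Y by exact: mulKVmx.
have CL : C *m L = low Z - Hi *m low Y *m H *m L by exact: mulmxKV.
have sA : strict_upper A.
  apply: cancelU; rewrite UA; apply: strict_upperB; first exact: strict_upper_up.
  by apply: mulU; exact: strict_upper_up.
have sC : strict_lower C.
  apply: cancelL; rewrite CL; apply: strict_lowerB; first exact: strict_lower_low.
  exact: mulL.
have sB i j : i != j -> B i j = 0.
  by move=> /negPf ij; rewrite !mxE ij subrr.
have BE : B = dg Z - dg Y by [].
clearbody A B C.
(* Multiplied by [U] on the left and by [L] on the right, this is equation [e]. *)
have : A *m H + B *m H + H *m C = 0.
  apply: (can_inj (mulKmx Uu)); apply: (can_inj (mulmxK Lu)).
  rewrite mulmx0 mul0mx !mulmxDr !mulmxDl (mulmxA U A) UA -!mulmxA CL.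
  rewrite BE !(mulmxBr, mulmxBl) -!mulmxA; apply/eqP.
  move/eqP: e; rewrite -subr_eq0 -!mulmxA; congr (_ == 0); rewrite !opprD.
  move: (up Z *m _) (U *m (up Y *m _)) (U *m (dg Z *m _)) (U *m (dg Y *m _)).
  move: (U *m (H *m (low Z))) (U *m (H *m _)) => c c' a a' b b'.
  by rewrite addrACA [X in X + _ = _]addrACA.
rewrite HE => /(upper_dg_lower_eq0 sA sB sC h0)[A0 B0 C0]; split.
- by apply/eqP; rewrite -subr_eq0 -UA A0 mulmx0.
- by apply/eqP; rewrite -subr_eq0 -BE B0.
- by apply/eqP; rewrite -subr_eq0 -HE -CL C0 mul0mx.
Qed.

Definition cols_gt (q : 'I_N) W : 'M[K]_N :=
  \matrix_(i, j) (W i j *+ ((i < j) && (q < j))%N).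

(* Only the columns of [W] to the right of [q] enter [A], hence [T]. *)
Lemma riccati_column W M (q i : 'I_N) : (i < q)%N ->
  let U := 1%:M + up W in
  let A := 1%:M + cols_gt q W in
  let T := invmx A *m M *m A in
  (U *m up (invmx U *m M *m U)) i q =
  T i q + \sum_(j : 'I_N | (j < q)%N) T i j * W j q - W i q * T q q
   - W i q * \sum_(j : 'I_N | (j < q)%N) T q j * W j q.
Proof.
move=> iq U A T.
(* [X] is column [q] of [up W], [B] gathers the columns to its left, and [P] projects onto the
   coordinates below [q]. The aim is [U = A (1 + X) (1 + B)]. *)
pose X : 'M[K]_N := \matrix_(a, b) (W a b *+ ((a < b) && (b == q))%N).
pose B : 'M[K]_N := \matrix_(a, b) (W a b *+ ((a < b) && (b < q))%N).
pose P : 'M[K]_N := \matrix_(a, b) ((a == b) && (b < q)%N)%:R.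
have mul0E (C D : 'M[K]_N) (p : pred 'I_N) : (forall a b, ~~ p b -> C a b = 0) ->
    (forall a b, p a -> D a b = 0) -> C *m D = 0.
  move=> hC hD; apply/matrixP => a b; rewrite !mxE big1// => c _.
  by case: (boolP (p c)) => pc; [rewrite hD// mulr0|rewrite hC// mul0r].
have zz (a : K) (b : bool) : ~~ b -> a *+ b = 0 by move/negPf->.
have AX : A *m X = X.
  rewrite mulmxDl mul1mx (mul0E _ _ (fun b => q < b)%N) ?addr0// => a b qb; rewrite mxE zz//.
    by rewrite (negPf qb) andbF.
  by apply/negP => /andP[ab /eqP e]; move: qb ab; rewrite e; lia.
have XX : X *m X = 0.
  rewrite (mul0E _ _ (fun b => b == q))// => a b qb; rewrite mxE zz//.
    by rewrite (negPf qb) andbF.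
  by rewrite (eqP qb); apply/negP => /andP[ab /eqP e]; move: ab; rewrite e ltnn.
have AA : A \in unitmx.
  suff -> : A = 1%:M + up (\matrix_(a, b) (W a b *+ (q < b)%N)) by exact: unitri_up_unit.
  by apply/matrixP => a b; rewrite !mxE; case: (a < b)%N.
have UU : U \in unitmx by exact: unitri_up_unit.
(* Since [X] has square zero, [1 - X] inverts [1 + X] and [V'] inverts [V]. *)
pose V := A *m (1%:M + X); pose V' := (1%:M - X) *m invmx A.
have V'V : V' *m V = 1%:M.
  rewrite /V /V' !mulmxA -(mulmxA _ (invmx A)) mulVmx// mulmx1.
  by rewrite mulmxBl mul1mx mulmxDr mulmx1 XX addr0 addrK.
have VE : V = 1%:M + (cols_gt q W + X) by rewrite /V mulmxDr mulmx1 AX addrA.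
have VD : V = A *m (1%:M + X) by [].
have V'D : V' = (1%:M - X) *m invmx A by [].
have UD : U = 1%:M + up W by [].
clearbody V V'.
have colsE (a b : 'I_N) : (b < q)%N -> (cols_gt q W + X) a b = 0.
  move=> bq; rewrite !mxE zz ?zz ?addr0//; last by apply/negP; lia.
  by rewrite -val_eqE/=; apply/negP; lia.
(* The columns of [V - 1] to the left of [q] vanish, and so do the rows of [B] from [q] on; hence
   their product is zero. *)
have UE : U = V *m (1%:M + B).
  rewrite mulmxDr mulmx1 VE mulmxDl mul1mx (mul0E _ _ (fun b => ~~ (b < q)%N)).
  - rewrite addr0 -addrA; congr (_ + _); apply/matrixP => a b; rewrite !mxE -val_eqE/=.
    case: (a < b)%N; last by rewrite !addr0.
    by case: (ssrnat.ltngtP b q); rewrite ?addr0 ?add0r.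
  - by move=> a b; rewrite negbK => bq; exact: colsE.
  - by move=> a b aq; rewrite mxE zz//; apply/negP; lia.
clearbody U.
have VP : V *m P = P.
  rewrite VE mulmxDl mul1mx (mul0E _ _ (fun b => ~~ (b < q)%N)) ?addr0//.
    by move=> a b; rewrite negbK => bq; exact: colsE.
  move=> a b aq; rewrite mxE; case: eqP => [e|//]; rewrite -e.
  by rewrite (negPf aq).
have PB : P *m B = B.
  apply/matrixP => a b; rewrite mxE (bigD1 a)//= big1 ?addr0 => [|c ca].
    rewrite !mxE eqxx/=; case: ltnP; rewrite ?mul1r// => qa.
    by rewrite mul0r zz//; apply/negP; lia.
  by rewrite mxE eq_sym (negPf ca) mul0r.
have BP : B *m P = B.
  apply/matrixP => a b; rewrite mxE (bigD1 b)//= big1 ?addr0 => [|c cb].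
    by rewrite !mxE eqxx/=; case: (b < q)%N; rewrite ?mulr1// andbF mulr0.
  by rewrite [P _ _]mxE (negPf cb) mulr0.
(* [P] commutes with [1 + B] and [V] fixes the range of [P], so [U P = P (1 + B)], where
   [1 + B = V' U]. *)
have comm : U *m P = P *m V' *m U.
  have BP1 : (1%:M + B) *m P = P *m (1%:M + B).
    by rewrite mulmxDl mul1mx BP mulmxDr mulmx1 PB.
  by rewrite UE -mulmxA BP1 mulmxA VP -[RHS]mulmxA (mulmxA V') V'V mul1mx.
(* In column [q], taking the strictly upper part amounts to multiplying by [P] on the left. *)
have upP (Y : 'M[K]_N) (a : 'I_N) : (U *m up Y) a q = (U *m P *m Y) a q.
  rewrite -mulmxA !mxE; apply: eq_bigr => b _; congr (_ * _).
  rewrite mxE [RHS]mxE (bigD1 b)//= big1 ?addr0 => [|c cb].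
    rewrite mxE eqxx/=.
    by rewrite mulr_natl.
  by rewrite mxE eq_sym (negPf cb) mul0r.
rewrite upP comm !mulmxA -(mulmxA _ U) mulmxV// mulmx1 -!mulmxA.
rewrite [LHS]mxE (bigD1 i)//= big1 ?addr0 => [|c ci]; last first.
  by rewrite mxE eq_sym (negPf ci) mul0r.
rewrite mxE eqxx iq mul1r.
(* [U] and [V] have the same column [q], because column [q] of [B] is zero. *)
have -> : (V' *m (M *m U)) i q = ((1%:M - X) *m T *m (1%:M + X)) i q.
  rewrite !mulmxA.
  have -> : (1%:M - X) *m invmx A *m M *m A *m (1%:M + X) = V' *m M *m V.
    by rewrite VD V'D !mulmxA.
  rewrite [LHS]mxE [RHS]mxE; apply: eq_bigr => c _; congr (_ * _).
  rewrite VE UD !mxE -!val_eqE/=; congr (_ + _).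
  by rewrite ltnn eqxx andbF andbT mulr0n add0r.
have Xq (c : 'I_N) : X c q = W c q *+ (c < q)%N by rewrite mxE eqxx andbT.
have XT (b : 'I_N) : ((1%:M - X) *m T) i b = T i b - W i q * T q b.
  rewrite mulmxBl mul1mx mxE [X in _ + X]mxE; congr (_ - _).
  rewrite mxE (bigD1 q)//= big1 ?addr0 => [|c cq]; first by rewrite Xq iq.
  by rewrite [X _ _]mxE (negPf cq) andbF mul0r.
rewrite mulmxDr mulmx1 [LHS]mxE XT [X in _ + X]mxE.
have -> : \sum_j ((1%:M - X) *m T) i j * X j q =
    \sum_(j : 'I_N | (j < q)%N) T i j * W j q
    - W i q * \sum_(j : 'I_N | (j < q)%N) T q j * W j q.
  rewrite mulr_sumr -sumrB [RHS]big_mkcond/=; apply: eq_bigr => c _; rewrite XT Xq.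
  by case: (c < q)%N; [rewrite mulr1n mulrBl mulrA|rewrite mulr0n mulr0].
rewrite !addrA; congr (_ - _); exact: addrAC.
Qed.

End Triangular.

(** * The product of exponentials *)

Section OrderedProducts.
Context (A : pzRingType) (n : nat).
Implicit Types (s : seq 'I_n) (P : pred 'I_n) (f : 'I_n -> A).
Local Notation ltI := (fun i j : 'I_n => (i < j)%N).

Lemma index_enum_sorted : pairwise ltI (index_enum 'I_n).
Proof.
rewrite -[index_enum _]/(Finite.enum _) -enumT.
rewrite -(pairwise_map val ltn) val_enum_ord -sorted_pairwise ?iota_ltn_sorted//.
exact: ltn_trans.
Qed.

(** The factors need not commute: in an increasing list the indices below [c] precede all the
    others. *)
Lemma prod_split s P f c : pairwise ltI s ->
  \prod_(i <- s | P i) f i =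
  \prod_(i <- s | P i && (i < c)%N) f i * \prod_(i <- s | P i && (c <= i)%N) f i.
Proof.
elim: s => [|i s IH]; first by rewrite !big_nil mulr1.
rewrite pairwise_cons => /andP[/allP is_ /IH {}IH]; rewrite !big_cons.
case: (P i) => //=; have [ci|ic] := leqP c i; last by rewrite IH mulrA.
have e : \prod_(j <- s | P j && (j < c)%N) f j = 1.
  rewrite big_seq_cond big1// => j /andP[/is_ /= ij /andP[_ jc]]; lia.
by rewrite IH e !mul1r.
Qed.

(** In the expansion, every term with at least two factors contains some [f i * f j] with
    [i < j]. *)
Lemma prod_1Dorth s P f : pairwise ltI s ->
  (forall i j, P i -> P j -> (i < j)%N -> f i * f j = 0) ->
  \prod_(i <- s | P i) (1 + f i) = 1 + \sum_(i <- s | P i) f i.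
Proof.
move=> + f0; elim: s => [|i s IH]; first by rewrite !big_nil addr0.
rewrite pairwise_cons => /andP[/allP is_ /IH {}IH]; rewrite !big_cons.
case: ifPn => // Pi; rewrite IH mulrDl mul1r mulrDr mulr1 big_seq_cond mulr_sumr.
rewrite [X in _ + (_ + X)]big1 ?addr0 => [|j /andP[/is_ ij Pj]]; last exact: f0.
by rewrite -big_seq_cond -addrA [_ + f i]addrC.
Qed.

End OrderedProducts.

Lemma prod_diag_mx (K : comPzRingType) (N : nat) (J : Type) (s : seq J) (P : pred J)
    (d : J -> 'rV[K]_N) :
  \prod_(j <- s | P j) diag_mx (d j) = diag_mx (\row_i \prod_(j <- s | P j) d j 0 i).
Proof.
elim: s => [|j s IH].
  rewrite big_nil (_ : \row_i _ = const_mx 1) ?diag_const_mx//.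
  by apply/rowP => i; rewrite !mxE big_nil.
rewrite big_cons IH; case: ifPn => Pj; last first.
  by congr diag_mx; apply/rowP => i; rewrite !mxE big_cons (negPf Pj).
rewrite -[_ * _]/(_ *m _) mulmx_diag; congr diag_mx.
by apply/rowP => i; rewrite !mxE big_cons Pj.
Qed.

(** Reduces sums and products over all generators to the diagonal ones when a diagonal entry is
    computed. *)
Lemma big_inj_support (T : Type) (idx : T) (op : Monoid.com_law idx)
    (I J : finType) (h : J -> I) (F : I -> T) :
  injective h -> (forall i, i \notin codom h -> F i = idx) ->
  \big[op/idx]_i F i = \big[op/idx]_j F (h j).
Proof.
move=> h_inj F0; rewrite (bigID [in codom h])/= [X in op _ X]big1; last exact: F0.
rewrite Monoid.mulm1 -big_uniq; last by rewrite map_inj_uniq ?enum_uniq.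
by rewrite big_map big_enum.
Qed.

Section SlBasisProduct.
Context (R : realType) (N : nat).
Local Notation X := (@sl_basis R N).
Local Notation n := (N ^ 2 - 1)%N.
Implicit Types (u : 'cV[R[i]]_n) (m : 'I_n) (p q : 'I_N).

(** The zero case is the default value of [sl_basis]; allowing it avoids proving that the listed
    positions exhaust the basis. *)
Variant upper_spec m : Prop :=
| UpperZero of X m = 0
| UpperUnit p q of (p < q)%N & m.+1 = upper_pos N p.+1 q.+1 & X m = delta_mx p q.

Variant lower_spec m : Prop :=
| LowerZero of X m = 0
| LowerUnit p q of (p < q)%N & m.+1 = lower_pos N p.+1 q.+1 & X m = delta_mx q p.

Lemma sl_basis_upperP m : (m < 'C(N, 2))%N -> upper_spec m.
Proof.
move=> hm.
have := erefl (X m); rewrite {2}/sl_basis.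
case: pickP => [[p q] /= /andP[pq /eqP h] e|_]; first exact: UpperUnit pq h e.
case: pickP => [[p q] /= /andP[_ /eqP]|_].
  by rewrite /diag_pos half_diagE; lia.
case: pickP => [[p q] /= /andP[pq /eqP]|_ e]; last exact: UpperZero.
by have := @lower_pos_gt N p.+1 q.+1 ltac:(lia) (ltn_ord q); have := ltn_ord q; lia.
Qed.

Lemma sl_basis_diagP m : ('C(N, 2) <= m < 'C(N, 2) + N.-1)%N ->
  exists l : 'I_N.-1, m = diag_idx l.
Proof.
move=> hm; have hl : (m - 'C(N, 2) < N.-1)%N by lia.
exists (Ordinal hl); apply/val_inj => /=.
by rewrite /diag_pos half_diagE; lia.
Qed.

Lemma sl_basis_diag_idx (l : 'I_N.-1) p q : X (diag_idx l) p q =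
  (p == l :> nat)%:R *+ (p == q) - (p == l.+1 :> nat)%:R *+ (p == q).
Proof.
have hl : (l < N)%N by have := ltn_ord l; lia.
have hl' : (l.+1 < N)%N by have := ltn_ord l; lia.
have hd : (diag_idx l).+1 = diag_pos N (Ordinal hl).+1 by rewrite /= /diag_pos addnS.
rewrite (@sl_basis_diag R N _ (Ordinal hl) (Ordinal hl') erefl hd) !mxE -!val_eqE/=.
case: (@eqP _ (p : nat) q) => [->|pq]; rewrite ?andbb ?mulr1n// !mulr0n.
have -> : ((p == l :> nat) && (q == l :> nat)) = false by lia.
by have -> : ((p == l.+1 :> nat) && (q == l.+1 :> nat)) = false by lia.
Qed.

Lemma sl_basis_lowerP m : ('C(N, 2) + N.-1 <= m)%N -> lower_spec m.
Proof.
move=> hm; have := erefl (X m); rewrite {2}/sl_basis.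
case: pickP => [[p q] /= /andP[pq /eqP]|_].
  by have := @upper_pos_bounds N p.+1 q.+1 ltac:(lia) (ltn_ord q); lia.
case: pickP => [[p q] /= /andP[/eqP pq /eqP]|_].
  by have := ltn_ord q; rewrite /diag_pos half_diagE; lia.
case: pickP => [[p q] /= /andP[pq /eqP h] e|_ e]; first exact: LowerUnit pq h e.
exact: LowerZero.
Qed.

Lemma sl_basis_segments m : [\/ (m < 'C(N, 2))%N, ('C(N, 2) <= m < 'C(N, 2) + N.-1)%N
  | ('C(N, 2) + N.-1 <= m)%N].
Proof.
have [?|?] := ltnP m 'C(N, 2); first by constructor 1.
by have [?|?] := ltnP m ('C(N, 2) + N.-1); [constructor 2; lia|constructor 3].
Qed.

Lemma sl_basis_gt m p q : (p < q)%N ->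
  X m p q = (m.+1 == upper_pos N p.+1 q.+1)%:R.
Proof.
move=> pq; case: eqP => [h|h]; first by rewrite (sl_basis_upper R pq h) mxE !eqxx.
case: (sl_basis_segments m) => hm.
- have [->|p' q' _ h' ->] := sl_basis_upperP hm; rewrite mxE//.
  by case: eqP => // e1; case: eqP => // e2; case: h; rewrite h' -e1 -e2.
- have [l ->] := sl_basis_diagP hm; rewrite sl_basis_diag_idx.
  by case: (p =P q) => [e|_]; [rewrite e ltnn in pq|rewrite subrr].
- have [->|p' q' p'q' h' ->] := sl_basis_lowerP hm; rewrite mxE//.
  by case: eqP => // /(congr1 val)/= e1; case: eqP => // /(congr1 val)/= e2; lia.
Qed.

Lemma sl_basis_lt m p q : (p < q)%N ->
  X m q p = (m.+1 == lower_pos N p.+1 q.+1)%:R.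
Proof.
move=> pq; case: eqP => [h|h]; first by rewrite (sl_basis_lower R pq h) mxE !eqxx.
case: (sl_basis_segments m) => hm.
- have [->|p' q' p'q' h' ->] := sl_basis_upperP hm; rewrite mxE//.
  by case: eqP => // /(congr1 val)/= e1; case: eqP => // /(congr1 val)/= e2; lia.
- have [l ->] := sl_basis_diagP hm; rewrite sl_basis_diag_idx.
  by case: (q =P p) => [e|_]; [rewrite e ltnn in pq|rewrite subrr].
- have [->|p' q' _ h' ->] := sl_basis_lowerP hm; rewrite mxE//.
  by case: eqP => // e1; case: eqP => // e2; case: h; rewrite h' -e1 -e2.
Qed.

Lemma sl_basis_diag0 m p : m \notin codom (@diag_idx N) -> X m p p = 0.
Proof.
move=> hm; case: (sl_basis_segments m) => h.
- have [->|p' q' pq' _ ->] := sl_basis_upperP h; rewrite mxE//.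
  by case: eqP => // /(congr1 val)/= e1; case: eqP => // /(congr1 val)/= e2; lia.
- by have [l ml] := sl_basis_diagP h; case/negP: hm; apply/codomP; exists l.
- have [->|p' q' pq' _ ->] := sl_basis_lowerP h; rewrite mxE//.
  by case: eqP => // /(congr1 val)/= e1; case: eqP => // /(congr1 val)/= e2; lia.
Qed.

(** A nonzero product of the units [(p, q)] and [(p', q')] forces [q = p' < q']; but columns further
    right come earlier in the basis, so [m' < m]. *)
Lemma upper_orth m m' : (m <= m')%N -> (m' < 'C(N, 2))%N -> X m *m X m' = 0.
Proof.
move=> mm' hm'.
have [->|p q pq h ->] := @sl_basis_upperP m ltac:(lia); first by rewrite mul0mx.
have [->|p' q' pq' h' ->] := sl_basis_upperP hm'; first by rewrite mulmx0.
rewrite mul_delta_mx_cond; case: eqP => // /(congr1 val)/= e; move: h h'.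
have := @half_posE N q.+1 ltac:(have := ltn_ord q; lia).
have := @half_posE N q'.+1 ltac:(have := ltn_ord q'; lia).
have := @bin2_lt q.+1 q'.+1 ltac:(lia).
rewrite /upper_pos; move: (_./2) (_./2) => x y; lia.
Qed.

(** A nonzero product of the units [(q, p)] and [(q', p')] forces [q' = p < q]; here smaller rows
    come earlier, so again [m' < m]. *)
Lemma lower_orth m m' : ('C(N, 2) + N.-1 <= m)%N -> (m <= m')%N -> X m *m X m' = 0.
Proof.
move=> hm mm'.
have [->|p q pq h ->] := sl_basis_lowerP hm; first by rewrite mul0mx.
have [->|p' q' pq' h' ->] := @sl_basis_lowerP m' ltac:(lia); first by rewrite mulmx0.
rewrite mul_delta_mx_cond; case: eqP => // /(congr1 val)/= e; move: h h'.
have := @lower_posE N p.+1 q.+1 ltac:(lia) (ltn_ord q).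
have := @lower_posE N p'.+1 q'.+1 ltac:(lia) (ltn_ord q').
have := @half_posE N q.+1 ltac:(have := ltn_ord q; lia).
have := @half_posE N q'.+1 ltac:(have := ltn_ord q'; lia).
have := @bin2_lt q'.+1 q.+1 ltac:(lia).
rewrite /upper_pos; move: (lower_pos _ _ _) (lower_pos _ _ _) => a b.
move: (_./2) (_./2) => x y; lia.
Qed.

Definition Ufactor u : 'M[R[i]]_N := 1%:M + up (sl_comb u).
Definition Lfactor u : 'M[R[i]]_N := 1%:M + low (sl_comb u).
(** The product runs over all generators: the off-diagonal ones have zero diagonal and contribute
    [cexp 0 = 1]. *)
Definition hfactor u : 'rV[R[i]]_N := \row_i \prod_(m < n) cexp (u m 0 * X m i i).

Lemma exp_prodE u :
  exp_prod u = Ufactor u *m diag_mx (hfactor u) *m Lfactor u.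
Proof.
rewrite /exp_prod (prod_split predT _ 'C(N, 2) (index_enum_sorted _))/=.
rewrite (prod_split (fun i => 'C(N, 2) <= i)%N _ ('C(N, 2) + N.-1) (index_enum_sorted _)).
rewrite mulrA; congr (_ * _ * _).
- rewrite (eq_bigr (fun m => 1 + u m 0 *: X m)); last first.
    by move=> m hm; rewrite mexp_sq0// -scalemxAl -scalemxAr upper_orth ?scaler0.
  rewrite prod_1Dorth ?index_enum_sorted//; last first.
    move=> m m' _ hm' mm'; rewrite -[_ * _]/(_ *m _) -scalemxAl -scalemxAr.
    by rewrite upper_orth ?scaler0// ltnW.
  (* The sum over the first segment is [up (sl_comb u)]: its generators vanish on and below the
     diagonal, all others vanish above it. *)
  congr (_ + _); apply/matrixP => i j; rewrite summxE mxE summxE -sumrMnl big_mkcond/=.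
  apply: eq_bigr => m _; rewrite mxE; have [ij|ij] := ltnP i j; case: ifPn => hm //.
    rewrite mulr1n sl_basis_gt// (_ : _ == _ = false) ?mulr0//; apply/negP => /eqP h.
    by have := @upper_pos_bounds N i.+1 j.+1 ltac:(lia) (ltn_ord j); lia.
  have [->|p q pq _ ->] := sl_basis_upperP hm; rewrite mxE ?mulr0//.
  rewrite (_ : _ && _ = false) ?mulr0n ?mulr0//; apply/negP.
  by move=> /andP[/eqP/(congr1 val)/= e1 /eqP/(congr1 val)/= e2]; lia.
- rewrite (eq_bigr (fun m => diag_mx (\row_i cexp (u m 0 * X m i i)))); last first.
    move=> m hm; have [l ml] := sl_basis_diagP hm.
    rewrite (_ : _ *: _ = diag_mx (\row_i (u m 0 * X m i i))).
      rewrite mexp_diag; congr diag_mx; apply/rowP => i; rewrite [LHS]mxE [RHS]mxE.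
      by congr cexp; rewrite mxE.
    apply/matrixP => i j; rewrite !mxE ml !sl_basis_diag_idx eqxx !mulr1n.
    by case: (eqVneq i j) => [->|_]; rewrite ?mulr1n// !mulr0n subrr mulr0.
  rewrite prod_diag_mx; congr diag_mx; apply/rowP => i; rewrite !mxE.
  rewrite big_mkcond/=; apply: eq_bigr => m _; rewrite mxE; case: ifPn => // hm.
  rewrite sl_basis_diag0 ?mulr0 ?cexp0//; apply: contra hm => /codomP[l ->] /=.
  by rewrite /diag_pos half_diagE; have := ltn_ord l; lia.
- rewrite (eq_bigl (fun m : 'I_n => 'C(N, 2) + N.-1 <= m)%N); last by move=> m /=; lia.
  rewrite (eq_bigr (fun m => 1 + u m 0 *: X m)); last first.
    by move=> m hm; rewrite mexp_sq0// -scalemxAl -scalemxAr lower_orth ?scaler0.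
  rewrite prod_1Dorth ?index_enum_sorted//; last first.
    move=> m m' hm _ mm'; rewrite -[_ * _]/(_ *m _) -scalemxAl -scalemxAr.
    by rewrite lower_orth ?scaler0// ltnW.
  congr (_ + _); apply/matrixP => i j; rewrite summxE mxE summxE -sumrMnl big_mkcond/=.
  apply: eq_bigr => m _; rewrite mxE; have [ij|ij] := ltnP j i; case: ifPn => hm //.
    rewrite mulr1n sl_basis_lt// (_ : _ == _ = false) ?mulr0//; apply/negP => /eqP h.
    by have := @lower_pos_gt N j.+1 i.+1 ltac:(lia) (ltn_ord i); have := ltn_ord i; lia.
  have [->|p q pq _ ->] := sl_basis_lowerP hm; rewrite mxE ?mulr0//.
  rewrite (_ : _ && _ = false) ?mulr0n ?mulr0//; apply/negP.
  by move=> /andP[/eqP/(congr1 val)/= e1 /eqP/(congr1 val)/= e2]; lia.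
Qed.

Lemma trace_sl_comb u : \sum_i sl_comb u i i = 0.
Proof.
rewrite -[LHS]/(\tr (sl_comb u)) raddf_sum/= big1// => m _; rewrite mxtraceZ.
suff -> : \tr (X m) = 0 by rewrite mulr0.
have tr_delta p q : p != q -> \tr (delta_mx p q : 'M[R[i]]_N) = 0.
  move=> /eqP pq; rewrite /mxtrace big1// => i _; rewrite mxE.
  by case: eqP => // ip; case: eqP => // iq; case: pq; rewrite -ip -iq.
case: (sl_basis_segments m) => hm.
- have [->|p q pq _ ->] := sl_basis_upperP hm; first exact: mxtrace0.
  by rewrite tr_delta// -val_eqE/= neq_ltn pq ?orbT.
- have [l e] := sl_basis_diagP hm.
  have hl : (l < N)%N by have := ltn_ord l; lia.
  have hl' : (l.+1 < N)%N by have := ltn_ord l; lia.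
  have hd : m.+1 = diag_pos N (Ordinal hl).+1 by rewrite e /= /diag_pos addnS.
  rewrite (sl_basis_diag R (erefl : Ordinal hl' = (Ordinal hl).+1 :> nat) hd).
  have tr1 p : \tr (delta_mx p p : 'M[R[i]]_N) = 1.
    rewrite /mxtrace (bigD1 p)//= mxE !eqxx big1 ?addr0// => i /negPf h.
    by rewrite mxE h.
  by rewrite raddfB/= !tr1 subrr.
- have [->|p q pq _ ->] := sl_basis_lowerP hm; first exact: mxtrace0.
  by rewrite tr_delta// -val_eqE/= neq_ltn pq ?orbT.
Qed.

(** Column [N - k] counted from 1 is column [N - k.+1] counted from 0. *)
Lemma sl_comb_upper u (k : 'I_N.-1) (i : 'I_(N - k.+1)) p q :
  p = i :> nat -> q = (N - k.+1)%N :> nat -> sl_comb u p q = ublock k u i 0.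
Proof.
move=> pi qk; have hi := ltn_ord i; have hk := ltn_ord k.
have h0 : (0 < upper_pos N i.+1 (N - k))%N by rewrite /upper_pos addnS.
have eP : upper_pos N p.+1 q.+1 = upper_pos N i.+1 (N - k).
  by congr upper_pos; lia.
rewrite summxE (bigD1 (upper_idx i))//= [X in _ + X]big1 ?addr0.
  by rewrite !mxE sl_basis_gt ?eP/= ?prednK ?eqxx ?mulr1//; lia.
move=> m /negPf hm; rewrite mxE sl_basis_gt; last by lia.
rewrite (_ : _ == _ = false) ?mulr0//; apply/negP => /eqP h; move/negP: hm; apply.
by rewrite -val_eqE/= -eqSS h eP prednK.
Qed.

Lemma sl_comb_lower u (k : 'I_N.-1) (i : 'I_(N - k.+1)) p q :
  p = (N - k.+1 - i.+1)%N :> nat -> q = (N - k.+1)%N :> nat ->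
  sl_comb u q p = utblock k u i 0.
Proof.
move=> pi qk; have hi := ltn_ord i; have hk := ltn_ord k.
have h0 : (0 < lower_pos N (N - k.+1 - i) (N - k))%N.
  by have := @lower_pos_gt N (N - k.+1 - i) (N - k) ltac:(lia) (leq_subr _ _); lia.
have eP : lower_pos N p.+1 q.+1 = lower_pos N (N - k.+1 - i) (N - k).
  by congr lower_pos; lia.
rewrite summxE (bigD1 (lower_idx i))//= [X in _ + X]big1 ?addr0.
  by rewrite !mxE sl_basis_lt ?eP/= ?prednK ?eqxx ?mulr1//; lia.
move=> m /negPf hm; rewrite mxE sl_basis_lt; last by lia.
rewrite (_ : _ == _ = false) ?mulr0//; apply/negP => /eqP h; move/negP: hm; apply.
by rewrite -val_eqE/= -eqSS h eP prednK.
Qed.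

Lemma diag_idx_inj : injective (@diag_idx N).
Proof.
move=> l l' /(congr1 val)/=; rewrite /diag_pos half_diagE !addnS/= => /addnI.
exact: val_inj.
Qed.

Lemma sl_comb_diag u p : sl_comb u p p =
  \sum_l vblock u l 0 * ((p == l :> nat)%:R - (p == l.+1 :> nat)%:R).
Proof.
rewrite summxE (@big_inj_support _ _ _ _ _ _ _ diag_idx_inj).
  by apply: eq_bigr => l _; rewrite !mxE sl_basis_diag_idx eqxx !mulr1n.
by move=> m hm; rewrite mxE sl_basis_diag0 ?mulr0.
Qed.

(** Shows that [hfactor u] depends on [vblock u] only, as the linear equations demand. *)
Lemma hfactorE u p : hfactor u 0 p =
  \prod_l cexp (vblock u l 0 * ((p == l :> nat)%:R - (p == l.+1 :> nat)%:R)).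
Proof.
rewrite mxE (@big_inj_support _ _ _ _ _ _ _ diag_idx_inj).
  by apply: eq_bigr => l _; rewrite !mxE sl_basis_diag_idx eqxx !mulr1n.
by move=> m hm; rewrite sl_basis_diag0 ?mulr0 ?cexp0.
Qed.

Lemma hfactor_neq0 u p : hfactor u 0 p != 0.
Proof. by rewrite mxE; apply/prodf_neq0 => m _; exact: cexp_neq0. Qed.

End SlBasisProduct.

(** Logarithmic derivatives add up over a product; keeping [f j t] as a factor avoids any division
    and fits [has_derive_cexp]. *)
Lemma has_derive_prod_log (R : realType) (I : set R) (t : R) (J : Type) (r : seq J)
    (f : J -> R -> R[i]) (l : J -> R[i]) :
  (forall j, has_derive I t (f j) (f j t * l j)) ->
  has_derive I t (fun s => \prod_(j <- r) f j s)
    ((\prod_(j <- r) f j t) * \sum_(j <- r) l j).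
Proof.
move=> fl; elim: r => [|j r IH].
  rewrite !big_nil mulr0; under [X in has_derive _ _ X]eq_fun do rewrite big_nil.
  exact: has_derive_cst.
rewrite !big_cons; under [X in has_derive _ _ X]eq_fun do rewrite big_cons.
have -> : f j t * (\prod_(j0 <- r) f j0 t) * (l j + \sum_(j0 <- r) l j0) =
  f j t * l j * (\prod_(j0 <- r) f j0 t) +
  f j t * ((\prod_(j0 <- r) f j0 t) * \sum_(j0 <- r) l j0).
  by rewrite mulrDr !mulrA; congr (_ + _); exact: mulrAC.
exact: (has_deriveM (fl j) IH).
Qed.

(** * Differentiating the product of exponentials *)

Section ExpProdDerive.
Context (R : realType) (N : nat) (I : set R) (t : R).
Local Notation n := (N ^ 2 - 1)%N.
Context (u : R -> 'cV[R[i]]_n) (l : 'cV[R[i]]_n).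
Hypothesis ul : is_derive_within I u t l.
Local Notation D := (has_derive I t).

Lemma has_derive_coord m : D (fun s => u s m 0) (l m 0).
Proof. by have /is_derive_withinP/(_ m 0) := ul. Qed.

Lemma has_derive_sl_comb i j : D (fun s => sl_comb (u s) i j) (sl_comb l i j).
Proof.
have e v : sl_comb v i j = \sum_(m < n) v m 0 * sl_basis R m i j.
  by rewrite summxE; apply: eq_bigr => m _; rewrite mxE.
rewrite e; under [X in has_derive _ _ X]eq_fun do rewrite e.
apply: (@has_derive_sum R I t _ _ _ (fun m s => u s m 0 * sl_basis R m i j)) => m _.
by apply: (@has_deriveZ R I t _ (fun s => u s m 0)); exact: has_derive_coord.
Qed.

Lemma has_derive_Ufactor i j : D (fun s => Ufactor (u s) i j) (up (sl_comb l) i j).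
Proof.
rewrite -[up _ _ _]add0r.
rewrite (_ : (fun s => _) = fun s => (1%:M : 'M[R[i]]_N) i j + up (sl_comb (u s)) i j);
  last by apply/funext => s; rewrite mxE.
apply: (has_deriveD (has_derive_cst _ _ _)).
rewrite mxE; under [X in has_derive _ _ X]eq_fun do rewrite mxE.
case: (i < j)%N; last by exact: has_derive_cst.
exact: has_derive_sl_comb.
Qed.

Lemma has_derive_Lfactor i j : D (fun s => Lfactor (u s) i j) (low (sl_comb l) i j).
Proof.
rewrite -[low _ _ _]add0r.
rewrite (_ : (fun s => _) = fun s => (1%:M : 'M[R[i]]_N) i j + low (sl_comb (u s)) i j);
  last by apply/funext => s; rewrite mxE.
apply: (has_deriveD (has_derive_cst _ _ _)).
rewrite mxE; under [X in has_derive _ _ X]eq_fun do rewrite mxE.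
case: (j < i)%N; last by exact: has_derive_cst.
exact: has_derive_sl_comb.
Qed.

Lemma has_derive_hfactor p :
  D (fun s => hfactor (u s) 0 p) (hfactor (u t) 0 p * sl_comb l p p).
Proof.
have -> : sl_comb l p p = \sum_(m < n) l m 0 * sl_basis R m p p.
  by rewrite summxE; apply: eq_bigr => m _; rewrite mxE.
rewrite mxE; under [X in has_derive _ _ X]eq_fun do rewrite mxE.
apply: (@has_derive_prod_log R I t _ _ (fun m s => cexp (u s m 0 * sl_basis R m p p))) => m.
apply: (@has_derive_cexp R I t (fun s => u s m 0 * sl_basis R m p p)).
by apply: (@has_deriveZ R I t _ (fun s => u s m 0)); exact: has_derive_coord.
Qed.

Lemma is_derive_exp_prod :
  let U := Ufactor (u t) in let L := Lfactor (u t) in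
  let H := diag_mx (hfactor (u t)) in let Z := sl_comb l in
  is_derive_within I (fun s => exp_prod (u s)) t
    (up Z *m H *m L + U *m (dg Z *m H) *m L + U *m H *m low Z).
Proof.
move=> U L H Z; apply/is_derive_withinP => i j.
have e s : exp_prod (u s) i j =
    \sum_p Ufactor (u s) i p * hfactor (u s) 0 p * Lfactor (u s) p j.
  by rewrite exp_prodE mxE; apply: eq_bigr => p _; rewrite mul_mx_diag mxE.
under [X in has_derive _ _ X]eq_fun do rewrite e.
have -> : (up Z *m H *m L + U *m (dg Z *m H) *m L + U *m H *m low Z) i j =
  \sum_p ((up Z i p * hfactor (u t) 0 p + U i p * (hfactor (u t) 0 p * Z p p)) * L p j
    + U i p * hfactor (u t) 0 p * low Z p j).
  rewrite mxE [X in X + _]mxE [X in X + _ + _]mxE [X in _ + X + _]mxE [X in _ + X]mxE.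
  rewrite -!big_split/=; apply: eq_bigr => p _.
  rewrite /dg mulmx_diag !mul_mx_diag mulrDl; congr (_ * _ + _ * _ + _ * _);
    rewrite [LHS]mxE//.
  by congr (_ * _); rewrite [LHS]mxE [X in X * _]mxE mulrC.
apply: (@has_derive_sum R I t _ _ _ (fun p s =>
  Ufactor (u s) i p * hfactor (u s) 0 p * Lfactor (u s) p j)) => p _.
exact: (has_deriveM (has_deriveM (@has_derive_Ufactor i p) (@has_derive_hfactor p))
  (@has_derive_Lfactor p j)).
Qed.

End ExpProdDerive.

(** * Coefficient functions *)

Section Coefficients.
Context (R : realType) (N : nat).
Local Notation C := R[i].
Local Notation n := (N ^ 2 - 1)%N.
Implicit Types (a u l : 'cV[C]_n) (k : 'I_N.-1) (w : blocks_all R N) (v : 'cV[C]_N.-1).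

Lemma block_col_proof k : (N - k.+1 < N)%N.
Proof. by have := ltn_ord k; lia. Qed.

Definition block_col k : 'I_N := Ordinal (block_col_proof k).

Definition block_row k (i : 'I_(N - k.+1)) : 'I_N := widen_ord (leq_subr k.+1 N) i.

Lemma block_row_lt k (i : 'I_(N - k.+1)) : (block_row i < block_col k)%N.
Proof. exact: (ltn_ord i). Qed.

Lemma block_col_lt k k' : (block_col k < block_col k')%N = (k' < k)%N.
Proof. by rewrite /=; have := ltn_ord k; have := ltn_ord k'; lia. Qed.

(** Replaces a position above the diagonal by block coordinates, the range of [i] depending on
    [k]. *)
Variant upper_cell_spec : 'I_N -> 'I_N -> Prop :=
| UpperCell k (i : 'I_(N - k.+1)) : upper_cell_spec (block_row i) (block_col k).

Lemma upper_cellP (p q : 'I_N) : (p < q)%N -> upper_cell_spec p q.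
Proof.
move=> pq; have hk : (N - q.+1 < N.-1)%N by have := ltn_ord q; lia.
have [k qk] : exists k, q = block_col k.
  by exists (Ordinal hk); apply/val_inj => /=; have := ltn_ord q; lia.
move: pq; rewrite {}qk => hi.
have -> : p = block_row (Ordinal (hi : (p < N - k.+1)%N)) by exact/val_inj.
by constructor.
Qed.

Definition upper_mx w : 'M[C]_N :=
  \sum_k \sum_i w k i 0 *: delta_mx (block_row i) (block_col k).

Lemma upper_mx_cell w k (i : 'I_(N - k.+1)) :
  upper_mx w (block_row i) (block_col k) = w k i 0.
Proof.
rewrite summxE (bigD1 k)//= [X in _ + X]big1 ?addr0 => [|k' k'k].
  rewrite summxE (bigD1 i)//= [X in _ + X]big1 ?addr0 => [|j ji].
    by rewrite !mxE !eqxx mulr1.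
  by rewrite !mxE eqxx andbT -val_eqE/= eq_sym val_eqE (negPf ji) mulr0.
rewrite summxE big1// => j _; rewrite !mxE (_ : block_col k == _ = false) ?andbF ?mulr0//.
apply/negbTE; apply: contra k'k => /eqP/(congr1 val)/= e; apply/eqP/val_inj => /=.
by have := ltn_ord k; have := ltn_ord k'; lia.
Qed.

Lemma upper_mx_eq0 w (p q : 'I_N) : (q <= p)%N -> upper_mx w p q = 0.
Proof.
move=> qp; rewrite summxE big1// => k _; rewrite summxE big1// => i _; rewrite !mxE.
case: eqP => [pE|]; last by rewrite mulr0.
case: eqP => [qE|]; last by rewrite mulr0.
by have := block_row_lt i; rewrite -pE -qE; lia.
Qed.

(* [rev_ord]: the coordinates of a row are listed by decreasing column. *)
Definition lower_mx w : 'M[C]_N := (upper_mx (fun k => \col_i w k (rev_ord i) 0))^T.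

(** Blocks outside the domain are set to 0; [pselect] supplies the proof of [k' < k] that [w k']
    takes as argument. *)
Definition extend_lt k (w : blocks_lt R k) : blocks_all R N := fun k' =>
  if pselect (k' < k)%N is left h then w k' h else 0.

Definition extend_gt k (w : blocks_gt R k) : blocks_all R N := fun k' =>
  if pselect (k < k')%N is left h then w k' h else 0.

Lemma extend_ltE k u k' :
  extend_lt (ublocks_lt k u) k' = if (k' < k)%N then ublock k' u else 0.
Proof. by rewrite /extend_lt /ublocks_lt; case: pselect => [->|/negP/negPf ->]. Qed.

Lemma extend_gtE k u k' :
  extend_gt (utblocks_gt k u) k' = if (k < k')%N then utblock k' u else 0.
Proof. by rewrite /extend_gt /utblocks_gt; case: pselect => [->|/negP/negPf ->]. Qed.

Lemma upper_mx_ublocks u : upper_mx (ublocks u) = up (sl_comb u).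
Proof.
apply/matrixP => p q; rewrite [RHS]mxE; have [qp|pq] := leqP q p.
  by rewrite upper_mx_eq0.
rewrite mulr1n.
by case: (upper_cellP pq) => k i; rewrite upper_mx_cell (@sl_comb_upper R N u k i).
Qed.

Lemma lower_mx_utblocks u : lower_mx (fun k => utblock k u) = low (sl_comb u).
Proof.
apply/matrixP => q p; rewrite mxE [RHS]mxE; have [qp|pq] := leqP q p.
  by rewrite upper_mx_eq0.
rewrite mulr1n; case: (upper_cellP pq) => k i; rewrite upper_mx_cell mxE.
rewrite (@sl_comb_lower R N u k (rev_ord i))//=.
by have := ltn_ord i; lia.
Qed.

(** Block indices decrease from left to right, so the blocks before [k] are exactly the columns to
    the right of [block_col k]. *)
Lemma upper_mx_extend_lt k u :
  upper_mx (extend_lt (ublocks_lt k u)) = cols_gt (block_col k) (sl_comb u).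
Proof.
apply/matrixP => p q; rewrite [RHS]mxE; have [qp|pq] := leqP q p.
  by rewrite upper_mx_eq0.
case: (upper_cellP pq) => k' i.
rewrite upper_mx_cell block_col_lt extend_ltE/=.
by case: ifP => _; rewrite ?mxE// (@sl_comb_upper R N u k' i)// mxE.
Qed.

Lemma lower_mx_extend_gt k u (q p : 'I_N) : (q < block_col k)%N ->
  lower_mx (extend_gt (utblocks_gt k u)) q p = low (sl_comb u) q p.
Proof.
rewrite mxE => qk; rewrite -lower_mx_utblocks mxE.
have [qp|pq] := leqP q p; first by rewrite !upper_mx_eq0.
case: (upper_cellP pq) qk => k' i qk; rewrite !upper_mx_cell !mxE extend_gtE.
by rewrite -block_col_lt qk ?mxE.
Qed.

(** The matrix [T] of [riccati_column], from which the three Riccati coefficients below are read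
    off. *)
Definition conj_lt k a (w : blocks_lt R k) : 'M[C]_N :=
  let A := 1%:M + upper_mx (extend_lt w) in invmx A *m sl_comb a *m A.

Definition riccati_c k a (w : blocks_lt R k) : 'cV[C]_(N - k.+1) :=
  \col_i conj_lt a w (block_row i) (block_col k).

Definition riccati_C k a (w : blocks_lt R k) : 'M[C]_(N - k.+1) :=
  \matrix_(i, j) conj_lt a w (block_row i) (block_row j)
  - (conj_lt a w (block_col k) (block_col k))%:M.

Definition riccati_b k a (w : blocks_lt R k) : 'cV[C]_(N - k.+1) :=
  \col_i - conj_lt a w (block_col k) (block_row i).

Definition conj_all a w : 'M[C]_N :=
  let U := 1%:M + upper_mx w in invmx U *m sl_comb a *m U.

(** Diagonal entry [p] of a combination of the generators is [v_p - v_(p-1)], so partial sums along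
    the diagonal recover the coordinates [v]. *)
Definition diag_f a w : 'cV[C]_N.-1 :=
  \col_j \sum_(p : 'I_N | (p <= j)%N) conj_all a w p p.

Definition diag_h v : 'rV[C]_N :=
  \row_p \prod_j cexp (v j 0 * ((p == j :> nat)%:R - (p == j.+1 :> nat)%:R)).

Definition linear_d k a w v (wt : blocks_gt R k) : 'cV[C]_(N - k.+1) :=
  \col_i (diag_mx (\row_p (diag_h v 0 p)^-1) *m low (conj_all a w) *m diag_mx (diag_h v)
    *m (1%:M + lower_mx (extend_gt wt))) (block_col k) (block_row (rev_ord i)).

Lemma diag_h_vblock u : diag_h (vblock u) = hfactor u.
Proof. by apply/rowP => p; rewrite hfactorE [LHS]mxE. Qed.

Lemma conj_all_ublocks a u :
  conj_all a (ublocks u) = invmx (Ufactor u) *m sl_comb a *m Ufactor u.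
Proof. by rewrite /conj_all upper_mx_ublocks. Qed.

(** Above the diagonal the entries are compared cell by cell through [riccati_column]; elsewhere
    both matrices vanish. *)
Lemma riccati_blocks a u l :
  let U := Ufactor u in let Y := invmx U *m sl_comb a *m U in
  up (sl_comb l) = U *m up Y <->
  forall k, ublock k l = riccati_c a (ublocks_lt k u)
     + riccati_C a (ublocks_lt k u) *m ublock k u
     + ublock k u *m (ublock k u)^T *m riccati_b a (ublocks_lt k u).
Proof.
move=> U Y.
have E k (i : 'I_(N - k.+1)) :
    (U *m up Y) (block_row i) (block_col k) =
    (riccati_c a (ublocks_lt k u)
     + riccati_C a (ublocks_lt k u) *m ublock k u
     + ublock k u *m (ublock k u)^T *m riccati_b a (ublocks_lt k u)) i 0.
  rewrite /U /Y riccati_column ?block_row_lt// -upper_mx_extend_lt -/(conj_lt _ _).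
  set T := conj_lt a _; rewrite (@sl_comb_upper R N u k i)//.
  (* Indices below [block_col k] are the rows of block [k], which turns the sums into products of
     block matrices. *)
  rewrite !(big_ord_narrow (leq_subr k.+1 N)).
  have xE j : sl_comb u (widen_ord (leq_subr k.+1 N) j) (block_col k) = ublock k u j 0.
    exact: sl_comb_upper.
  rewrite [RHS]mxE [X in _ = X + _]mxE [riccati_c _ _ _ _]mxE mulmxBl.
  rewrite [X in _ = _ + X + _]mxE [X in _ = _ + (X + _) + _]mxE mul_scalar_mx.
  rewrite [X in _ = _ + (_ + X) + _]mxE [X in _ = _ + (_ - X) + _]mxE.
  rewrite -mulmxA [X in _ = _ + X]mxE big_ord1 [(_^T *m _) _ _]mxE !addrA.
  rewrite [T _ _ * _]mulrC; congr (_ + _ - _ + _).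
  - by apply: eq_bigr => j _; rewrite [X in _ = X * _]mxE xE.
  - rewrite -mulrN -sumrN; congr (_ * _); apply: eq_bigr => j _.
    by rewrite [X in _ = X * _]mxE [X in _ = _ * X]mxE xE mulrN mulrC.
have sl k (i : 'I_(N - k.+1)) :
    up (sl_comb l) (block_row i) (block_col k) = ublock k l i 0.
  by rewrite mxE block_row_lt mulr1n (@sl_comb_upper R N l k i).
split=> h.
  by move=> k; apply/colP => i; rewrite -E -h sl.
apply/matrixP => p q; have [qp|pq] := leqP q p.
  rewrite (strict_upper_up _ qp); symmetry; apply: strict_upper_mul qp.
  exact: strict_upper_up.
by case: (upper_cellP pq) => k i; rewrite sl h E.
Qed.

Lemma lower_blocks a u l :
  let Y := invmx (Ufactor u) *m sl_comb a *m Ufactor u in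
  low (sl_comb l) = diag_mx (\row_p (hfactor u 0 p)^-1) *m low Y *m
    diag_mx (hfactor u) *m Lfactor u <->
  forall k, utblock k l =
    linear_d a (ublocks u) (vblock u) (utblocks_gt k u).
Proof.
move=> Y; set B := diag_mx _ *m low Y *m _.
have sB : strict_lower B.
  move=> i j ij; rewrite /B mul_mx_diag mul_diag_mx !mxE.
  by rewrite ltnNge ij mulr0 mul0r.
have E k (i : 'I_(N - k.+1)) :
    (B *m Lfactor u) (block_col k) (block_row (rev_ord i)) =
    linear_d a (ublocks u) (vblock u) (utblocks_gt k u) i 0.
  rewrite [RHS]mxE diag_h_vblock conj_all_ublocks -/Y -/B.
  rewrite mxE [RHS]mxE; apply: eq_bigr => c _.
  (* Strict lower triangularity of [B] leaves only rows of [L] above [block_col k], which come from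
     blocks of index greater than [k]. *)
  have [kc|ck] := leqP (block_col k) c; first by rewrite sB ?mul0r.
  by congr (_ * _); rewrite [LHS]mxE [RHS]mxE lower_mx_extend_gt.
have sl k (i : 'I_(N - k.+1)) :
    low (sl_comb l) (block_col k) (block_row (rev_ord i)) = utblock k l i 0.
  by rewrite mxE block_row_lt mulr1n (@sl_comb_lower R N l k i).
split=> h.
  by move=> k; apply/colP => i; rewrite -E -h sl.
apply/matrixP => q p; have [qp|pq] := leqP q p.
  rewrite (strict_lower_low _ qp); symmetry; apply: strict_lower_mul qp.
  exact: sB.
by case: (upper_cellP pq) => k i; rewrite -(rev_ordK i) sl h E.
Qed.

(** The first [N - 1] partial sums along the diagonal give the equations for [v]; the last one is
    the trace, which vanishes on both sides. *)
Lemma diag_blocks a u l :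
  let Y := invmx (Ufactor u) *m sl_comb a *m Ufactor u in
  dg (sl_comb l) = dg Y <-> vblock l = diag_f a (ublocks u).
Proof.
move=> Y.
have delta_sum (c : nat) (m : nat) : (c < N)%N ->
    \sum_(p : 'I_N | (p <= m)%N) (p == c :> nat)%:R = (c <= m)%:R :> C.
  move=> cN; rewrite big_mkcond (bigD1 (Ordinal cN))//= eqxx big1 ?addr0.
    by case: ifP.
  by move=> p pc; case: ifP => // _; rewrite (_ : (_ == _) = false)//; exact: negbTE.
have Z_sum (j : 'I_N.-1) :
    \sum_(p : 'I_N | (p <= j)%N) sl_comb l p p = vblock l j 0.
  under eq_bigr do rewrite sl_comb_diag.
  rewrite exchange_big/= (bigD1 j)//= [X in _ + X]big1 ?addr0 => [|j' j'j].
    rewrite -mulr_sumr sumrB !delta_sum ?leqnn ?ltnn ?subr0 ?mulr1//;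
      by have := ltn_ord j; lia.
  (* For [j'] different from [j], the initial segment up to [j] contains both or neither of the
     positions [j'] and [j'.+1], whose contributions cancel. *)
  rewrite -mulr_sumr sumrB !delta_sum; try by have := ltn_ord j'; lia.
  have -> : (j' < j)%N = (j' <= j)%N by rewrite ltn_neqAle j'j.
  by rewrite subrr mulr0.
split=> [h|h].
  apply/colP => j; rewrite -Z_sum mxE conj_all_ublocks; apply: eq_bigr => p _.
  by move/matrixP: h => /(_ p p); rewrite !mxE eqxx !mulr1n.
have S0 (m : 'I_N) : \sum_(p : 'I_N | (p <= m)%N) (sl_comb l p p - Y p p) = 0.
  have [mN|Nm] := ltnP m N.-1.
    rewrite sumrB (Z_sum (Ordinal mN)) h mxE conj_all_ublocks.
    exact: subrr.
  rewrite (eq_bigl predT); last by move=> p /=; have := ltn_ord p; lia.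
  rewrite sumrB trace_sl_comb -[X in _ - X]/(\tr Y) mxtrace_mulC mulmxA.
  by rewrite mulmxV ?unitri_up_unit// mul1mx /mxtrace trace_sl_comb subrr.
suff D0 p : sl_comb l p p - Y p p = 0.
  congr diag_mx; apply/rowP => p; rewrite [LHS]mxE [RHS]mxE.
  exact/subr0_eq/D0.
(* All partial sums of the differences vanish, hence so does each difference, by strong
   induction. *)
have [m] := ubnP p; elim: m p => // m IH p pm.
have := S0 p; rewrite (bigD1 p)//= big1 ?addr0// => p' /andP[p'p pp'].
by apply: IH; move: pp'; rewrite -val_eqE/=; lia.
Qed.

End Coefficients.

(** * The equivalence at a single time, then on the interval *)

Lemma is_derive_within_unique (R : realType) (p q : nat) (I : set R) (t : R)
    (FF : ProperFilter (within [set h | I (t + h)] 0^'))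
    (f : R -> 'M[R[i]]_(p, q)) l l' :
  is_derive_within I f t l -> is_derive_within I f t l' -> l = l'.
Proof.
move=> /is_derive_withinP fl /is_derive_withinP fl'; apply/matrixP => i j.
exact: has_derive_unique (fl i j) (fl' i j).
Qed.

Lemma is_derive_within_isolated (R : realType) (p q : nat) (I : set R) (t : R)
    (f : R -> 'M[R[i]]_(p, q)) l :
  within [set h | I (t + h)] 0^' set0 -> is_derive_within I f t l.
Proof. by move=> F0 A _; apply: filterS F0. Qed.

Section BlockDerivatives.
Context (R : realType) (N : nat) (I : set R) (t : R).
Context (u : R -> 'cV[R[i]]_(N ^ 2 - 1)) (l : 'cV[R[i]]_(N ^ 2 - 1)).
Hypothesis ul : is_derive_within I u t l.

Lemma is_derive_ublock k : is_derive_within I (fun s => ublock k (u s)) t (ublock k l).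
Proof.
apply/is_derive_withinP => i j; rewrite mxE.
under [X in has_derive _ _ X]eq_fun do rewrite mxE.
exact: has_derive_coord.
Qed.

Lemma is_derive_vblock : is_derive_within I (fun s => vblock (u s)) t (vblock l).
Proof.
apply/is_derive_withinP => i j; rewrite mxE.
under [X in has_derive _ _ X]eq_fun do rewrite mxE.
exact: has_derive_coord.
Qed.

Lemma is_derive_utblock k : is_derive_within I (fun s => utblock k (u s)) t (utblock k l).
Proof.
apply/is_derive_withinP => i j; rewrite mxE.
under [X in has_derive _ _ X]eq_fun do rewrite mxE.
exact: has_derive_coord.
Qed.

(** Uniqueness of the derivative turns the differential equation into the matrix identity of
    [factored_ode], whose three clauses are the three groups of block equations. *)
Lemma exp_prod_ode_blocks (FF : ProperFilter (within [set h | I (t + h)] 0^'))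
    (a : 'cV[R[i]]_(N ^ 2 - 1)) :
  is_derive_within I (fun s => exp_prod (u s)) t (sl_comb a *m exp_prod (u t)) <->
  [/\ forall k, ublock k l = riccati_c a (ublocks_lt k (u t))
       + riccati_C a (ublocks_lt k (u t)) *m ublock k (u t)
       + ublock k (u t) *m (ublock k (u t))^T *m riccati_b a (ublocks_lt k (u t)),
      vblock l = diag_f a (ublocks (u t))
    & forall k, utblock k l =
        linear_d a (ublocks (u t)) (vblock (u t)) (utblocks_gt k (u t))].
Proof.
have K' := is_derive_exp_prod ul.
set U := Ufactor (u t) in K'; set L := Lfactor (u t) in K'.
set H := diag_mx _ in K'.
have e : sl_comb a *m exp_prod (u t) = U *m (invmx U *m sl_comb a *m U) *m H *m L.
  by rewrite exp_prodE !mulmxA mulmxV ?unitri_up_unit// mul1mx.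
have ode := @factored_ode R[i] N (sl_comb (u t)) (sl_comb (u t))
  (invmx U *m sl_comb a *m U) (sl_comb l) _ (hfactor_neq0 (u t)).
have [h1 h2] := riccati_blocks a (u t) l.
have [h3 h4] := diag_blocks a (u t) l.
have [h5 h6] := lower_blocks a (u t) l.
split=> [MK|[hu hv hw]].
  have /ode[/h1 ? /h3 ? /h5 ?] : _ = _ := etrans (is_derive_within_unique FF K' MK) e.
  by split.
rewrite e; have <- := (proj2 ode (And3 (h2 hu) (h4 hv) (h6 hw))).
exact: K'.
Qed.

End BlockDerivatives.

Theorem mainTheorem1 (R : realType) (N : nat) (hN : (2 <= N)%N) :
  exists (c b : forall k : 'I_N.-1,
            'cV[R[i]]_(N ^ 2 - 1) -> blocks_lt R k -> 'cV[R[i]]_(N - k.+1))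
         (C : forall k : 'I_N.-1,
            'cV[R[i]]_(N ^ 2 - 1) -> blocks_lt R k -> 'M[R[i]]_(N - k.+1))
         (f : 'cV[R[i]]_(N ^ 2 - 1) -> blocks_all R N -> 'cV[R[i]]_N.-1)
         (d : forall k : 'I_N.-1,
            'cV[R[i]]_(N ^ 2 - 1) -> blocks_all R N -> 'cV[R[i]]_N.-1 ->
            blocks_gt R k -> 'cV[R[i]]_(N - k.+1))
         (D : forall k : 'I_N.-1,
            'cV[R[i]]_(N ^ 2 - 1) -> blocks_all R N -> 'cV[R[i]]_N.-1 ->
            blocks_gt R k -> 'M[R[i]]_(N - k.+1)),
  forall (I : set R) (a u : R -> 'cV[R[i]]_(N ^ 2 - 1)),
    is_interval I ->
    (forall t, I t -> exists l, is_derive_within I u t l) ->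
    (forall t, I t ->
       is_derive_within I (fun s => exp_prod (u s)) t
         (sl_comb (a t) *m exp_prod (u t)))
    <->
    (forall t, I t ->
       [/\ forall k : 'I_N.-1,
             is_derive_within I (fun s => ublock k (u s)) t
               (c k (a t) (ublocks_lt k (u t))
                + C k (a t) (ublocks_lt k (u t)) *m ublock k (u t)
                + ublock k (u t) *m (ublock k (u t))^T
                    *m b k (a t) (ublocks_lt k (u t))),
           is_derive_within I (fun s => vblock (u s)) t
             (f (a t) (ublocks (u t)))
         & forall k : 'I_N.-1,
             is_derive_within I (fun s => utblock k (u s)) t
               (d k (a t) (ublocks (u t)) (vblock (u t)) (utblocks_gt k (u t))
                + D k (a t) (ublocks (u t)) (vblock (u t)) (utblocks_gt k (u t))
                    *m utblock k (u t))]).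
Proof.
(* The matrix of the linear equations is 0: [linear_d] carries their whole right-hand side. *)
exists (fun k => @riccati_c R N k), (fun k => @riccati_b R N k),
  (fun k => @riccati_C R N k), (@diag_f R N), (fun k => @linear_d R N k),
  (fun k _ _ _ _ => 0).
move=> I a u _ du.
(* In each direction, the first case is that of an isolated [t], where every derivative statement
   holds vacuously. *)
split=> ode t It; have {ode} := ode t It; have [l ul] := du t It;
    have [F0|F0] := pselect (within [set h | I (t + h)] 0^' set0).
- by split=> *; exact: is_derive_within_isolated.
- have FF : ProperFilter (within [set h | I (t + h)] 0^') by apply: Build_ProperFilter.
  move=> /(exp_prod_ode_blocks ul FF)[hu hv hw]; split=> [k||k].
  + by rewrite -hu; exact: is_derive_ublock.
  + by rewrite -hv; exact: is_derive_vblock.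
  + by rewrite mul0mx addr0 -hw; exact: is_derive_utblock.
- by move=> _; exact: is_derive_within_isolated.
- have FF : ProperFilter (within [set h | I (t + h)] 0^') by apply: Build_ProperFilter.
  move=> [hu hv hw]; apply/(exp_prod_ode_blocks ul FF); split=> [k||k].
  + apply: (@is_derive_within_unique _ _ _ _ _ FF _ _ _ _ (hu k)).
    exact: is_derive_ublock.
  + apply: (@is_derive_within_unique _ _ _ _ _ FF _ _ _ _ hv).
    exact: is_derive_vblock.
  + have := hw k; rewrite mul0mx addr0.
    by apply: (@is_derive_within_unique _ _ _ _ _ FF); exact: is_derive_utblock.
Qed.
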